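(* Let $v\ge 8$ be an integer. The following statements are equivalent: (i) for every abelian group $A$ of order $v$ whose Sylow $2$-subgroup is cyclic, there exists an $A$-reversible $\mathrm{SQS}(v)$; (ii) for some abelian group $A$ of order $v$ whose Sylow $2$-subgroup is cyclic, there exists an $A$-reversible $\mathrm{SQS}(v)$; (iii) there exists an $S$-cyclic $\mathrm{SQS}(v)$; (iv) $v\equiv 0\pmod 2$, $v\not\equiv 0\pmod 3$, $v\not\equiv 0\pmod 8$, and for every odd prime divisor $p$ of $v$ there exists an $S$-cyclic $\mathrm{SQS}(2p)$.
   Context: A Steiner quadruple system $\mathrm{SQS}(v)$ is a pair $(V,\mathcal B)$ where $V$ is a set of $v$ points and $\mathcal B$ is a collection of $4$-element subsets (blocks) of $V$ such that every $3$-element subset of $V$ is contained in exactly one block. For a finite abelian group $A$ (written additively), let $\hat A=A\rtimes\langle\sigma\rangle$ be the permutation group on $A$ generated by all translations $x\mapsto x+a$ ($a\in A$) and the map $\sigma:x\mapsto -x$; thus the $\hat A$-orbit of a subset $X\subseteq A$ is $\{X+a: a\in A\}\cup\{-X+a: a\in A\}$. A subset $B\subseteq A$ is symmetric if $B=-B+x$ for some $x\in A$. An $\mathrm{SQS}(v)$ with point set $A$ ($|A|=v$) is $A$-reversible if every block is symmetric and the set of blocks is invariant under $\hat A$. An $S$-cyclic $\mathrm{SQS}(v)$ is a $\mathbb Z_v$-reversible $\mathrm{SQS}(v)$, where $\mathbb Z_v$ is the cyclic group of order $v$. *)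

(* Defs.v *)
From HB Require Import structures.
From mathcomp Require Import all_boot all_order all_algebra all_fingroup.
From mathcomp Require Import all_solvable.

Set Implicit Arguments.
Unset Strict Implicit.
Unset Printing Implicit Defensive.

Import GroupScope GRing.Theory.
Local Open Scope ring_scope.

Definition is_SQS (V : finType) (Bs : {set {set V}}) : Prop :=
  (forall B : {set V}, B \in Bs -> #|B| = 4%N) /\
  (forall T : {set V}, #|T| = 3%N -> exists! B : {set V}, B \in Bs /\ T \subset B).

(* [{group A}], [cyclic] and [Sylow] below refer to the additive group of A. *)
Definition cyclic_Sylow2 (A : finZmodType) : Prop :=
  forall P : {group A}, 2.-Sylow([set: A]) P -> cyclic P.

Definition translation (A : finZmodType) (a : A) : {perm A} :=
  perm (addIr a).

Definition negation (A : finZmodType) : {perm A} := perm (@oppr_inj A).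

Definition hat (A : finZmodType) : {group {perm A}} :=
  <<negation A |: [set translation a | a : A]>>%G.

Definition symmetric_set (A : finZmodType) (B : {set A}) : Prop :=
  exists x : A, B = [set - b + x | b in B].

Definition reversible_SQS (A : finZmodType) (Bs : {set {set A}}) : Prop :=
  [/\ is_SQS Bs,
      forall B : {set A}, B \in Bs -> symmetric_set B
    & [acts hat A, on Bs | 'P^*]].

Definition has_reversible_SQS (A : finZmodType) : Prop :=
  exists Bs : {set {set A}}, reversible_SQS Bs.

(* 'Z_v has v elements only for 1 < v, so this is meaningful only then. *)
Definition has_S_cyclic_SQS (v : nat) : Prop := has_reversible_SQS 'Z_v.

Lemma translationE (A : finZmodType) (a x : A) : translation a x = x + a.
Proof. by rewrite permE. Qed.

Lemma negationE (A : finZmodType) (x : A) : negation A x = - x.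
Proof. by rewrite permE. Qed.

Lemma translation_hat (A : finZmodType) (a : A) : translation a \in hat A.
Proof. by rewrite mem_gen // setU1r // imset_f. Qed.

Lemma negation_hat (A : finZmodType) : negation A \in hat A.
Proof. by rewrite mem_gen // setU11. Qed.

Lemma hatP (A : finZmodType) (s : {perm A}) :
  reflect (exists e : bool, exists a : A, forall x, s x = (if e then - x else x) + a)
          (s \in hat A).
Proof.
apply: (iffP idP) => [|[e [a Es]]]; last first.
  have -> : s = (negation A ^+ e * translation a)%g.
    apply/permP => x; rewrite Es permM translationE; congr (_ + _).
    by case: (e); rewrite ?expg1 ?negationE ?expg0 ?perm1.
  by rewrite groupM ?groupX ?negation_hat ?translation_hat.
case/gen_prodgP => n [c Hc ->] {s}.
elim: n c Hc => [|n IHn] c Hc.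
  by exists false, 0 => x; rewrite big_ord0 perm1 addr0.
have [|e [a Ea]] := IHn (fun i => c (lift ord0 i)) => //.
rewrite big_ord_recl; have := Hc ord0; rewrite in_setU1.
case/orP => [/eqP->|/imsetP[b _ ->]].
  exists (~~ e), a => x; rewrite permM Ea negationE.
  by case: (e); rewrite ?opprK.
exists e, ((if e then - b else b) + a) => x; rewrite permM Ea translationE.
by case: (e); rewrite ?opprD addrA.
Qed.

Lemma orbit_hatP (A : finZmodType) (X Y : {set A}) :
  reflect ((exists a, Y = [set x + a | x in X]) \/
           (exists a, Y = [set - x + a | x in X]))
          (Y \in orbit 'P^* (hat A) X).
Proof.
apply: (iffP orbitP) => [[s /hatP[e [a Es]] <-]|].
  by case: e Es => Es; [right | left]; exists a; apply: eq_imset => x /=;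
     rewrite /aperm Es.
case=> [[a ->]|[a ->]].
  exists (translation a); first exact: translation_hat.
  by apply: eq_imset => x /=; rewrite /aperm translationE.
exists (negation A * translation a)%g.
  by rewrite groupM ?negation_hat ?translation_hat.
by apply: eq_imset => x /=; rewrite /aperm permM translationE negationE.
Qed.

(* Main.v *)
(* Let h be the unique involution of A.  Up to the action of hat A, a triple of
   points {0, a, a + b} is a multiset {a, b, -(a + b)} of three differences up
   to a common sign, and a symmetric quadruple is either {0, a, b, a + b} or
   {0, h, r, -r}.  In an A-reversible system all quadruples of the second kind
   are forced; what remains is to choose, for each nondegenerate triple, exactly
   one of the three pairs {a, b}, {b, a + b}, {a, a + b}, compatibly with the
   quadruples {0, a, b, a + b}, each of which joins the triples {a, b, -(a + b)}
   and {a, -b, b - a}.  Such a choice is a perfect matching of the adjacency graph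
   (the Koehler graph), here called a selector.

   Necessity of (iv): selectors restrict along injective homomorphisms, they do
   not exist on the cyclic group of order 8, and 3-torsion is impossible.

   Sufficiency: a selector is built along a chain of subgroups of prime index p
   starting at the Sylow 2-subgroup.  For K < H of index p, with phi : H -> F_p,
   triples inside H but not inside K are matched by looking at phi and at the
   projection to the Sylow 2-subgroup, of order 2 or 4.  Triples of odd-order
   type use the selector on F_p when their image is nondegenerate, and otherwise
   the pairs of types (y, -y) and (y, y) modulo K are matched with each other.
   The only problem is the part with elements of order divisible by 4: there the
   quotient of the graph by the units of F_p consists of two paths of length about
   p/2 joined by rungs, with one fibre of half size, and a matching is
   obtained from alternating paths between fibres that differ by a quadratic
   nonresidue.  This requires p = 1 mod 4, which follows from counting a selector
   on F_p: its pairs form free orbits under signs and swaps, so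
   24 divides (p - 1)(p - 5). *)

Require Import Defs.
From mathcomp Require Import all_boot all_order all_algebra all_fingroup.
From mathcomp Require Import all_solvable.
From mathcomp Require Import ring zify.

Set Implicit Arguments.
Unset Strict Implicit.
Unset Printing Implicit Defensive.

Import GRing.Theory.
Local Open Scope ring_scope.

(** * Linear identities in abelian groups *)

Inductive zexpr :=
  | ZVar of nat | ZZero | ZAdd of zexpr & zexpr | ZOpp of zexpr
  | ZMuln of zexpr & nat.

Fixpoint zeval (A : zmodType) (e : seq A) t : A :=
  match t with
  | ZVar i => e`_i
  | ZZero => 0
  | ZAdd t1 t2 => zeval e t1 + zeval e t2
  | ZOpp t1 => - zeval e t1
  | ZMuln t1 n => zeval e t1 *+ n
  end.

Fixpoint zcoef i t : int :=
  match t with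
  | ZVar j => (i == j)%:Z
  | ZZero => 0
  | ZAdd t1 t2 => zcoef i t1 + zcoef i t2
  | ZOpp t1 => - zcoef i t1
  | ZMuln t1 n => zcoef i t1 *+ n
  end.

Lemma zevalE (A : zmodType) (e : seq A) t :
  zeval e t = \sum_(i < size e) e`_i *~ zcoef i t.
Proof.
elim: t => [j||t1 IH1 t2 IH2|t1 IH1|t1 IH1 n] /=.
- have [lt_j|ge_j] := ltnP j (size e).
    rewrite (bigD1 (Ordinal lt_j)) //= eqxx mulr1z big1 ?addr0 // => i ne_ij.
    by rewrite -val_eqE /= in ne_ij; rewrite (negPf ne_ij) mulr0z.
  rewrite nth_default // big1 // => i _.
  by rewrite ltn_eqF ?mulr0z // (leq_trans (ltn_ord i)).
- by rewrite big1 // => i _; rewrite mulr0z.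
- by rewrite IH1 IH2 -big_split; apply: eq_bigr => i _; rewrite mulrzDr.
- by rewrite IH1 -sumrN; apply: eq_bigr => i _; rewrite mulrNz.
- rewrite IH1 -sumrMnl; apply: eq_bigr => i _.
  by rewrite -[zcoef i t1 *+ n]mulr_natr natz mulrzA.
Qed.

(** Reflection behind [zmod]: only integer coefficients are compared, by computation, while the
    atoms listed in [e] stay opaque. *)
Lemma zeval_eq (A : zmodType) (e : seq A) t1 t2 :
  all (fun i => zcoef i t1 == zcoef i t2) (iota 0 (size e)) ->
  zeval e t1 = zeval e t2.
Proof.
move=> /allP eq_t; rewrite !zevalE; apply: eq_bigr => i _.
by rewrite (eqP (eq_t i _)) // mem_iota ltn_ord.
Qed.

Ltac zindex x e :=
  lazymatch e with
  | x :: _ => constr:(0%N)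
  | _ :: ?e' => let i := zindex x e' in constr:(i.+1)
  end.
Ltac zmem x e :=
  lazymatch e with
  | x :: _ => constr:(true)
  | _ :: ?e' => zmem x e'
  | _ => constr:(false)
  end.
Ltac zvars t e :=
  lazymatch t with
  | ?a + ?b => let e' := zvars a e in zvars b e'
  | - ?a => zvars a e
  | ?a *+ _ => zvars a e
  | 0 => e
  | ?a => let b := zmem a e in
          lazymatch b with true => e | false => constr:(a :: e) end
  end.
Ltac zreify t e :=
  lazymatch t with
  | ?a + ?b => let u := zreify a e in let v := zreify b e in constr:(ZAdd u v)
  | - ?a => let u := zreify a e in constr:(ZOpp u)
  | ?a *+ ?n => let u := zreify a e in constr:(ZMuln u n)
  | 0 => constr:(ZZero)
  | ?a => let i := zindex a e in constr:(ZVar i)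
  end.
Ltac zmod :=
  lazymatch goal with
  | |- @eq ?T ?t ?u =>
    let e0 := zvars t (@nil T) in let e := zvars u e0 in
    let a := zreify t e in let b := zreify u e in
    exact: (@zeval_eq _ e a b isT)
  end.

Lemma eq_comb (A : zmodType) (l r u v : A) : l = r -> u + r = v + l -> u = v.
Proof. by move=> -> /addIr. Qed.

Ltac zby H := first [ apply: (eq_comb H); zmod | apply: (eq_comb (esym H)); zmod ].
Ltac zby2 H K := first [ apply: (eq_comb H); zby K | apply: (eq_comb (esym H)); zby K ].

Ltac zadd H := apply: (eq_comb H).
Ltac zsub H := apply: (eq_comb (esym H)).
(** These search for an integer combination of the hypotheses, with coefficients between -2 and 2,
    that turns the goal into a formal identity. *)
Ltac zany1 H := first [ zmod | zadd H; zmod | zsub H; zmod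
  | zadd H; zadd H; zmod | zsub H; zsub H; zmod ].
Ltac zany2 H K := first [ zany1 K | zadd H; zany1 K | zsub H; zany1 K
  | zadd H; zadd H; zany1 K | zsub H; zsub H; zany1 K ].
Ltac zany3 H K L := first [ zany2 K L | zadd H; zany2 K L | zsub H; zany2 K L
  | zadd H; zadd H; zany2 K L | zsub H; zsub H; zany2 K L ].

(** * Nondegenerate and degenerate triples *)

Definition one3 (x y z : bool) := (x + y + z == 1)%N.

Lemma one3_swap12 x y z : one3 x y z = one3 y x z.
Proof. by case: x; case: y; case: z. Qed.

Lemma one3_swap23 x y z : one3 x y z = one3 x z y.
Proof. by case: x; case: y; case: z. Qed.

(** For [h != 0] this makes [h] the unique involution; for [h = 0] it expresses the absence of
    2-torsion. *)
Definition torsion2 (A : zmodType) (h : A) :=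
  forall x : A, (x *+ 2 == 0) = (x == 0) || (x == h).

Definition torsion3_free (A : zmodType) := forall x : A, x *+ 3 = 0 -> x = 0.

(* The triple {a, b, -(a + b)} consists of three distinct elements, none of them
   0 or h; [h = 0] is allowed, for groups of odd order. *)
Definition nd (A : zmodType) (h a b : A) :=
  [&& [&& a != 0, b != 0, a + b != 0, a != h, b != h & a + b != h],
      a != b, a *+ 2 + b != 0 & a + b *+ 2 != 0].

(* {0, u, w, d} is a translate of a quadruple {0, h, r, -r}: the cases say which
   of its points form the pair differing by h. *)
Definition deg4 (A : zmodType) (h u w d : A) :=
  [\/ u = h /\ d = - w, w = h /\ d = - u | u + w = 0 /\ d = h] \/
  [\/ w = u + h /\ d = u *+ 2, w = u *+ 2 /\ d = u + h
    | u = w *+ 2 /\ d = w + h].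

Lemma torsion2_mul2 (A : zmodType) (h : A) : torsion2 h -> h *+ 2 = 0.
Proof. by move=> t2; apply/eqP; rewrite t2 eqxx orbT. Qed.

Lemma torsion2P (A : zmodType) (h x : A) :
  torsion2 h -> x *+ 2 = 0 -> x = 0 \/ x = h.
Proof. by move=> t2 /eqP; rewrite t2 => /orP[]/eqP; auto. Qed.

(** Two of the six descriptions with different fourth points would force [u = 0], [w = 0], [u = w]
    or [u *+ 3 = 0]. *)
Lemma deg4_inj (A : zmodType) (h u w d d' : A) :
  torsion2 h -> torsion3_free A -> u != 0 -> w != 0 -> u != w ->
  deg4 h u w d -> deg4 h u w d' -> d = d'.
Proof.
move=> /torsion2_mul2 h2 t3 /eqP nu /eqP nw /eqP nuw.
case=> [][][e ->] [][][e' ->];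
 first [ by zany3 e e' h2 | by case: nuw; zany3 e e' h2
  | by case: nu; zany3 e e' h2 | by case: nw; zany3 e e' h2
  | by case: nu; apply: t3; zany3 e e' h2 ].
Qed.

Lemma nd_sub (A : zmodType) (h u w : A) : torsion2 h ->
  nd h u (w - u) = [&& [&& u != 0, w != 0, u != w, u != h, w != h & w != u + h],
      u + w != 0, w != u *+ 2 & u != w *+ 2].
Proof.
move=> /torsion2_mul2 h2; rewrite /nd.
have -> : u + (w - u) = w by zmod.
have -> : u *+ 2 + (w - u) = u + w by zmod.
have -> : u + (w - u) *+ 2 = w *+ 2 - u by zmod.
rewrite subr_eq0 [w == u]eq_sym subr_eq [h + u]addrC.
rewrite [w *+ 2 - u == 0]subr_eq0 [w *+ 2 == u]eq_sym.
have -> : (u == w - u) = (w == u *+ 2).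
  by apply/eqP/eqP => e; zby e.
by do !case: (_ == _).
Qed.

Lemma deg4_nd (A : zmodType) (h u w d : A) :
  torsion2 h -> deg4 h u w d -> ~~ nd h u (w - u).
Proof.
move=> t2; rewrite nd_sub // => - [] [] [-> _];
  rewrite ?eqxx ?andbF ?subrr ?addrN ?addNr ?eqxx //.
Qed.

(** In the form of [nd_sub] the six conditions that may fail correspond one by one to the six cases
    of [deg4]. *)
Lemma nd_deg4 (A : zmodType) (h u w : A) : torsion2 h ->
  u != 0 -> w != 0 -> u != w -> ~~ nd h u (w - u) ->
  exists d, deg4 h u w d.
Proof.
move=> t2 nu nw nuw; rewrite nd_sub // nu nw nuw /= !negb_and !negbK.
rewrite -!orbA => /or4P[/eqP->|/eqP->|/eqP->|].
- by exists (- w); left; constructor 1.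
- by exists (- u); left; constructor 2.
- by exists (u *+ 2); right; constructor 1.
case/or3P => /eqP e.
- by exists h; left; constructor 3.
- by exists (u + h); right; constructor 2.
- by exists (w + h); right; constructor 3.
Qed.

(** * Reversible systems and selectors *)

(* [m a b] means that the block {0, a, b, a + b} is chosen; the last condition
   says that the other triple {a, -b, b - a} of that block is nondegenerate. *)
Definition selector (A : finZmodType) (h : A) (H : {set A}) (m : A -> A -> bool) :=
  [/\ {in H &, forall a b, m a b = m b a},
      {in H &, forall a b, m (- a) b = m a b},
      {in H &, forall a b, nd h a b -> one3 (m a b) (m a (a + b)) (m b (a + b))}
    & {in H &, forall a b, nd h a b -> m a b ->
         [&& a - b != h, a *+ 2 != b & b *+ 2 != a]}].

Lemma set4_uniq (T : finType) (x y z t : T) :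
  (#|[set x; y; z; t]| == 4)%N = uniq [:: x; y; z; t].
Proof.
rewrite (_ : #|[set x; y; z; t]| = #|[:: x; y; z; t]|); first exact/eqP/card_uniqP.
by apply: eq_card => i; rewrite !inE -!orbA.
Qed.

Lemma set3_uniq (T : finType) (x y z : T) :
  (#|[set x; y; z]| == 3)%N = uniq [:: x; y; z].
Proof.
rewrite (_ : #|[set x; y; z]| = #|[:: x; y; z]|); first exact/eqP/card_uniqP.
by apply: eq_card => i; rewrite !inE -!orbA.
Qed.

Lemma set4_of_card (T : finType) (B : {set T}) (x y z : T) :
  #|B| = 4%N -> x \in B -> y \in B -> z \in B -> uniq [:: x; y; z] ->
  exists t, B = [set x; y; z; t].
Proof.
move=> cB xB yB zB; rewrite -set3_uniq => /eqP c3.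
have sub : [set x; y; z] \subset B.
  by apply/subsetP => i; rewrite !inE -!orbA => /or3P[]/eqP->.
have /eqP/cards1P[t Et] : #|B :\: [set x; y; z]| = 1%N.
  by rewrite cardsD (setIidPr sub) cB c3.
exists t; rewrite -Et; apply/setP => i; rewrite in_setU in_setD.
by case: (boolP (i \in [set x; y; z])) => //= /(subsetP sub).
Qed.

Lemma set3_of_card (T : finType) (B : {set T}) :
  #|B| = 3%N -> exists x y z, uniq [:: x; y; z] /\ B = [set x; y; z].
Proof.
move=> cB; have: (0 < #|B|)%N by rewrite cB.
case/card_gt0P => x xB; have := cardsD1 x B; rewrite xB cB => -[] /esym/eqP.
case/cards2P => y [z [nyz E]]; exists x, y, z.
have EB : B = [set x; y; z] by rewrite -(setD1K xB) E setUA.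
by split=> //; rewrite -set3_uniq -EB cB.
Qed.

Lemma imset_set4 (T U : finType) (f : T -> U) (x y z t : T) :
  f @: [set x; y; z; t] = [set f x; f y; f z; f t].
Proof. by rewrite !imsetU !imset_set1. Qed.

Lemma mem_eq_set (T : finType) (S : {set {set T}}) (X Y : {set T}) :
  X =i Y -> X \in S -> Y \in S.
Proof. by move/setP->. Qed.

(** * From a reversible system to a selector *)

Section SelectorOfSystem.

Variables (A : finZmodType) (h : A) (Bs : {set {set A}}).
Hypotheses (t2 : torsion2 h) (revB : reversible_SQS Bs).

Lemma block_card B : B \in Bs -> #|B| = 4%N.
Proof. by case: revB => -[c _] _ _; apply: c. Qed.

Lemma block_ex (x y z : A) : uniq [:: x; y; z] ->
  exists t, [set x; y; z; t] \in Bs.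
Proof.
rewrite -set3_uniq => /eqP c3; case: revB => -[_ /(_ _ c3)[B [[BBs sub] _]]] _ _.
have inT i : i \in [:: x; y; z] -> i \in B.
  by move=> iT; apply: (subsetP sub); move: iT; rewrite !inE -!orbA.
have [||||t EB] := set4_of_card (block_card BBs) (x := x) (y := y) (z := z).
- by apply: inT; rewrite !inE eqxx.
- by apply: inT; rewrite !inE eqxx orbT.
- by apply: inT; rewrite !inE eqxx !orbT.
- by rewrite -set3_uniq c3.
by exists t; rewrite -EB.
Qed.

Lemma block_uniq (x y z t : A) : [set x; y; z; t] \in Bs -> uniq [:: x; y; z; t].
Proof. by move=> /block_card/eqP; rewrite set4_uniq. Qed.

Lemma block_inj (x y z t t' : A) :
  [set x; y; z; t] \in Bs -> [set x; y; z; t'] \in Bs -> t = t'.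
Proof.
move=> B1 B2; have u1 := block_uniq B1.
have c3 : #|[set x; y; z]| = 3%N.
  by apply/eqP; rewrite set3_uniq; move: u1; rewrite /= !inE !negb_or => /and4P[] /and3P[-> -> _] /andP[-> _].
case: revB => -[_ /(_ _ c3)[B [_ U]]] _ _.
have E1 := U _ (conj B1 (subsetUl _ _)); have E2 := U _ (conj B2 (subsetUl _ _)).
have: t \in [set x; y; z; t'] by rewrite -E2 E1 !inE eqxx !orbT.
move: u1; rewrite /= !inE !negb_or andbT => /and3P[/and3P[_ _ nx] /andP[_ ny] nz].
by rewrite eq_sym (negPf nx) eq_sym (negPf ny) eq_sym (negPf nz) => /eqP.
Qed.

Lemma block_hat (s : {perm A}) (x y z t : A) :
  s \in hat A -> [set x; y; z; t] \in Bs -> [set s x; s y; s z; s t] \in Bs.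
Proof.
move=> sA; case: revB => _ _ /actsP/(_ s sA) /(_ [set x; y; z; t]) <-.
by rewrite /= /setact imset_set4.
Qed.

Lemma block_add (e x y z t : A) :
  [set x; y; z; t] \in Bs -> [set x + e; y + e; z + e; t + e] \in Bs.
Proof. by move/(block_hat (translation_hat e)); rewrite !translationE. Qed.

Lemma block_opp (x y z t : A) :
  [set x; y; z; t] \in Bs -> [set - x; - y; - z; - t] \in Bs.
Proof. by move/(block_hat (negation_hat A)); rewrite !negationE. Qed.

(** The reflection [x - i] is an involution of the four points. Without fixed points it pairs them
    in one of three ways, which gives the three values of [d]. Otherwise it fixes two points, whose
    difference is 2-torsion and hence [h], and swaps the other two: this is [deg4]. *)
Lemma block_sym (u w d : A) : [set 0; u; w; d] \in Bs ->
  [\/ d = u + w, d = w - u | d = u - w] \/ deg4 h u w d.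
Proof.
move=> B1; case: revB => _ /(_ _ B1) [x Ex] _.
have sym (i : A) : i \in [set 0; u; w; d] -> [\/ x - i = 0, x - i = u | x - i = w] \/ x - i = d.
  move=> iB; have: x - i \in [set 0; u; w; d].
    by rewrite Ex addrC; apply/imsetP; exists i.
  by rewrite !inE -!orbA => /or4P[] /eqP; [left|left|left|right];
    [constructor 1|constructor 2|constructor 3|].
have s0 := sym 0; have su := sym u; have sw := sym w; have sd := sym d.
move: (block_uniq B1) s0 su sw sd.
rewrite /= !inE !negb_or !eqxx !orbT => /and4P[/and3P[/eqP n0u /eqP n0w /eqP n0d] /andP[/eqP nuw /eqP nud] /eqP nwd _].
move=> /(_ isT) s0 /(_ isT) su /(_ isT) sw /(_ isT) sd.
have h2 := torsion2_mul2 t2.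
have tP y : y *+ 2 = 0 -> y = 0 \/ y = h by apply: torsion2P.
have n0h (y z : A) : y *+ 2 = 0 -> z *+ 2 = 0 -> [\/ y = 0, z = 0 | y = z].
  move=> /tP ey /tP ez; case: ey ez => -> [] ->; by [constructor 1|constructor 2|constructor 3].
case: s0 => [[e0|e0|e0]|e0].
- case: su => [[eu|eu|eu]|eu]; first by case: n0u; zby2 e0 eu.
  + have u2 : u *+ 2 = 0 by zby2 e0 eu.
    have uh : u = h by case: (tP _ u2) => // uz; case: n0u.
    right; left; constructor 1; split=> //.
    case: sw => [[ew|ew|ew]|ew]; first by case: n0w; zby2 e0 ew.
    * by case: nuw; zany3 e0 eu ew.
    * have w2 : w *+ 2 = 0 by zby2 e0 ew.
      by case: (n0h _ _ u2 w2) => e; [case: n0u|case: n0w|case: nuw].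
    * by zby2 e0 ew.
  + have uw : u + w = 0 by zby2 e0 eu.
    right; left; constructor 3; split=> //.
    case: sd => [[ed|ed|ed]|ed]; first by case: n0d; zby2 e0 ed.
    * by case: nwd; zany3 e0 uw ed.
    * by case: nud; zany3 e0 uw ed.
    * have d2 : d *+ 2 = 0 by zby2 e0 ed.
      by case: (tP _ d2) => // dz; case: n0d.
  + case: sw => [[ew|ew|ew]|ew]; first by case: n0w; zby2 e0 ew.
    * by case: nwd; zany3 e0 eu ew.
    * have w2 : w *+ 2 = 0 by zby2 e0 ew.
      right; left; constructor 2; split; last by zany3 e0 eu ew.
      by case: (tP _ w2) => // wz; case: n0w.
    * by case: nuw; zany3 e0 eu ew.
- case: sw => [[ew|ew|ew]|ew]; first by case: nuw; zby2 e0 ew.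
  + by case: n0w; zby2 e0 ew.
  + case: sd => [[ed|ed|ed]|ed]; first by case: nud; zby2 e0 ed.
    * by case: n0d; zby2 e0 ed.
    * by case: nwd; zany3 e0 ew ed.
    * have: (d - w) *+ 2 = 0 by zany3 e0 ew ed.
      case/tP => e; first by case: nwd; zby e.
      right; right; constructor 3; split; last by zby e.
      by zany3 e0 ew ed.
  + by left; constructor 3; zany2 e0 ew.
- case: su => [[eu|eu|eu]|eu]; first by case: nuw; zby2 e0 eu.
  + case: sd => [[ed|ed|ed]|ed]; first by case: nwd; zby2 e0 ed.
    * by case: nud; zany3 e0 eu ed.
    * by case: n0d; zany3 e0 eu ed.
    * have: (d - u) *+ 2 = 0 by zany3 e0 eu ed.
      case/tP => e; first by case: nud; zby e.
      right; right; constructor 2; split; last by zby e.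
      by zany3 e0 eu ed.
  + by case: n0u; zby2 e0 eu.
  + by left; constructor 2; zany2 e0 eu.
- case: su => [[eu|eu|eu]|eu]; first by case: nud; zby2 e0 eu.
  + case: sw => [[ew|ew|ew]|ew]; first by case: nwd; zby2 e0 ew.
    * by case: nuw; zany3 e0 eu ew.
    * have: (w - u) *+ 2 = 0 by zany3 e0 eu ew.
      case/tP => e; first by case: nuw; zby e.
      right; right; constructor 1; split; first by zby e.
      by zany3 e0 eu ew.
    * by case: n0w; zany3 e0 eu ew.
  + by left; constructor 1; zany2 e0 eu.
  + by case: n0u; zany2 e0 eu.
Qed.

(* If 3r = 0 the block through {0, r, -r} would be fixed by translation by r. *)
Lemma system_torsion3_free : torsion3_free A.
Proof.
move=> r r3; have [//|/eqP nr] := r =P 0; exfalso.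
have nr2 : r != - r by apply/eqP => e; case/eqP: nr; zby2 e r3.
have u0 : uniq [:: 0; r; - r].
  by rewrite /= !inE !negb_or [0 == r]eq_sym nr [0 == - r]eq_sym oppr_eq0 nr nr2.
have [t B1] := block_ex u0.
have B2 : [set 0; r; - r; t + r] \in Bs.
  have := block_add r B1; rewrite add0r addNr (_ : r + r = - r); last by zby r3.
  refine (mem_eq_set _) => i; rewrite !inE.
  by case: (i == 0); case: (i == r); case: (i == - r).
by case/eqP: nr; have e := block_inj B1 B2; zby e.
Qed.

(* A block {-r, 0, r, 2r} and its opposite would share the triple {-r, 0, r}. *)
Lemma block_forced (r : A) : r *+ 2 != 0 -> [set 0; h; r; - r] \in Bs.
Proof.
move=> /eqP n2; have t3 := system_torsion3_free; have h2 := torsion2_mul2 t2.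
have nr : r != 0 by apply/eqP => e; case: n2; zby2 e e.
have nr2 : r != - r by apply/eqP => e; case: n2; zby e.
have u0 : uniq [:: 0; r; - r].
  by rewrite /= !inE !negb_or [0 == r]eq_sym nr [0 == - r]eq_sym oppr_eq0 nr nr2.
have [t B1] := block_ex u0.
suff th : t = h.
  move: B1; rewrite th; refine (mem_eq_set _) => i; rewrite !inE.
  by case: (i == 0); case: (i == r); case: (i == - r); rewrite ?orbT ?orbF.
have B2 : [set 0; r; - r; - t] \in Bs.
  have := block_opp B1; rewrite oppr0 opprK.
  refine (mem_eq_set _) => i; rewrite !inE.
  by case: (i == 0); case: (i == r); case: (i == - r).
have et := block_inj B1 B2.
have t4 : t = r *+ 2 \/ t = - r *+ 2 -> t = h.
  move=> e; have: t *+ 2 = 0 by zby et.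
  by case/(torsion2P t2) => // tz; case: n2; case: e => e; zby2 e tz.
case: (block_sym B1) => [[]|[][]] e.
- by have := block_uniq B1; rewrite /= !inE e subrr eqxx !orbT.
- by apply: t4; right; zby e.
- by apply: t4; left; zby e.
- by case: e => e _; case: n2; zany2 e h2.
- by case: e => e _; case: n2; zany2 e h2.
- by case: e.
- by case: e => e ->; zany2 e h2.
- by case: e => e _; case/eqP: nr; apply: t3; zby e.
- by case: e => e _; case/eqP: nr; apply: t3; zby e.
Qed.

(** For a nondegenerate triple {0, a, a + b} [block_sym] leaves only three parallelograms, one for
    each pair in the selector rule, and the Steiner property picks exactly one. *)
Lemma selector_of_system (nh : h != 0) :
  selector h [set: A] (fun a b => [set 0; a; b; a + b] \in Bs).
Proof.
have h2 := torsion2_mul2 t2.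
have shift x y z t e x' y' z' t' : [set x; y; z; t] \in Bs ->
    [set x + e; y + e; z + e; t + e] = [set x'; y'; z'; t'] ->
    [set x'; y'; z'; t'] \in Bs.
  by move=> B1 <-; apply: block_add.
have symC : {in [set: A] &, forall a b,
    ([set 0; a; b; a + b] \in Bs) = ([set 0; b; a; b + a] \in Bs)}.
  move=> a b _ _; rewrite [b + a]addrC; congr (_ \in Bs); apply/setP => i; rewrite !inE.
  by case: (i == 0); case: (i == a); case: (i == b).
(* Otherwise a translate of the chosen block shares three points with a translate of the forced
   block {0, h, a, -a}, but not the fourth. *)
have dbl a b : nd h a b -> [set 0; a; b; a + b] \in Bs ->
    (a - b != h) && (a *+ 2 != b).
  rewrite /nd -!andbA => /and5P[na nb nab nah /and5P[nbh nabh ne n21 n12]] B1.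
  have na2 : a *+ 2 != 0 by rewrite t2 negb_or na.
  have F := block_forced na2.
  apply/andP; split; apply/eqP => e.
    have F' : [set 0; a; b; a *+ 2] \in Bs.
      apply: (shift _ _ _ _ a _ _ _ _ F).
      rewrite add0r addNr (_ : h + a = b); last by zany2 e h2.
      apply/setP => i; rewrite !inE -mulr2n.
      by case: (i == a); case: (i == b); case: (i == 0); rewrite ?orbT ?orbF.
    by case/eqP: ne; have e' := block_inj B1 F'; zby e'.
  have F' : [set 0; a; - a; b] \in Bs.
    apply: (shift _ _ _ _ (- a) _ _ _ _ B1).
    rewrite add0r subrr (_ : b - a = a); last by zby e.
    rewrite (_ : a + b - a = b); last by zmod.
    apply/setP => i; rewrite !inE.
    by case: (i == a); case: (i == b); case: (i == 0); rewrite ?orbT ?orbF.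
  suff F2 : [set 0; a; - a; h] \in Bs by case/eqP: nbh; apply: block_inj F' F2.
  move: F; refine (mem_eq_set _) => i; rewrite !inE.
  by case: (i == a); case: (i == - a); case: (i == 0); rewrite ?orbT ?orbF.
split=> //.
- move=> a b _ _; apply/idP/idP => B1; [apply: (shift _ _ _ _ a _ _ _ _ B1)|apply: (shift _ _ _ _ (- a) _ _ _ _ B1)];
  rewrite add0r ?addNr ?subrr.
    rewrite (_ : - a + b + a = b) 1?[b + a]addrC; last by zmod.
    by apply/setP => i; rewrite !inE; case: (i == a); case: (i == b); case: (i == 0); rewrite ?orbT ?orbF.
  rewrite (_ : a + b - a = b) 1?[b - a]addrC; last by zmod.
  by apply/setP => i; rewrite !inE; case: (i == - a); case: (i == b); case: (i == 0); rewrite ?orbT ?orbF.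
- move=> a b _ _ ndab.
  have := ndab; rewrite /nd -!andbA => /and5P[na nb nab nah /and5P[nbh nabh ne n21 n12]].
  (* The three blocks are viewed as completions of the common triple {0, a, a + b} by [b],
     [a + (a + b)] and [- b]; two equal completions would give a 2-torsion element excluded by
     [nd]. *)
  have perm1 : ([set 0; a; b; a + b] \in Bs) = ([set 0; a; a + b; b] \in Bs).
    congr (_ \in Bs); apply/setP => i; rewrite !inE.
    by case: (i == 0); case: (i == a); case: (i == b); rewrite ?orbT ?orbF.
  have perm3 : ([set 0; b; a + b; b + (a + b)] \in Bs) = ([set 0; a; a + b; - b] \in Bs).
    apply/idP/idP => B1; [apply: (shift _ _ _ _ (- b) _ _ _ _ B1)|apply: (shift _ _ _ _ b _ _ _ _ B1)];
    rewrite add0r ?addNr ?subrr.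
      rewrite (_ : a + b - b = a); last by zmod.
      rewrite (_ : b + (a + b) - b = a + b); last by zmod.
      by apply/setP => i; rewrite !inE; case: (i == - b); case: (i == a); case: (i == 0); rewrite ?orbT ?orbF.
    rewrite [a + b + b]addrC.
    by apply/setP => i; rewrite !inE; case: (i == b); case: (i == a + b); case: (i == 0); rewrite ?orbT ?orbF.
  rewrite perm1 perm3 /one3.
  have u0 : uniq [:: 0; a; a + b].
    rewrite /= !inE !negb_or [0 == a]eq_sym [0 == a + b]eq_sym na nab /= andbT.
    by apply/eqP => e; case/eqP: nb; zby e.
  have ex : [\/ [set 0; a; a + b; b] \in Bs, [set 0; a; a + b; a + (a + b)] \in Bs
      | [set 0; a; a + b; - b] \in Bs].
    have [t B1] := block_ex u0; case: (block_sym B1) => [[]|D].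
    + by move=> e; constructor 2; rewrite -e.
    + by move=> e; have et : t = b; [zby e|rewrite et in B1; constructor 1].
    + by move=> e; have et : t = - b; [zby e|rewrite et in B1; constructor 3].
    + by have := deg4_nd t2 D; rewrite (_ : a + b - a = b) ?ndab //; zmod.
  case: (boolP (_ \in Bs)) ex => B1; case: (boolP (_ \in Bs)) => B2;
   case: (boolP (_ \in Bs)) => B3 //; try by case.
  + have e := block_inj B1 B2; have /eqP: a *+ 2 = 0 by zby e.
    by rewrite t2 (negPf na) (negPf nah).
  + have e := block_inj B1 B2; have /eqP: a *+ 2 = 0 by zby e.
    by rewrite t2 (negPf na) (negPf nah).
  + have e := block_inj B1 B3; have /eqP: b *+ 2 = 0 by zby e.
    by rewrite t2 (negPf nb) (negPf nbh).
  + have e := block_inj B2 B3; have /eqP: (a + b) *+ 2 = 0 by zby e.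
    by rewrite t2 (negPf nab) (negPf nabh).
- move=> a b _ _ ndab B1.
  have /andP[-> ->] := dbl a b ndab B1.
  rewrite symC ?inE // in B1.
  have: nd h b a.
    move: ndab; rewrite /nd [b + a]addrC [a *+ 2 + b]addrC [a + b *+ 2]addrC [a == b]eq_sym.
    by do !case: (_ != _).
  by move=> /dbl /(_ B1) /andP[_ ->].
Qed.
End SelectorOfSystem.

(** * From a selector to a reversible system *)

Ltac set_perm :=
  let i := fresh "i" in apply/setP => i; rewrite !inE;
  repeat match goal with |- context [i == ?x] => case: (i == x) end; done.

Lemma ndC (A : zmodType) (h a b : A) : nd h a b = nd h b a.
Proof.
rewrite /nd [b + a]addrC [b *+ 2 + a]addrC [b + a *+ 2]addrC [b == a]eq_sym.
by do !case: (_ != _).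
Qed.

Lemma ndNN (A : zmodType) (h a b : A) : torsion2 h -> nd h (- a) (- b) = nd h a b.
Proof.
move=> /torsion2_mul2 h2.
have Nh (x : A) : (- x == h) = (x == h).
  by apply/eqP/eqP => e; zby2 e h2.
rewrite /nd -opprD !oppr_eq0 !Nh eqr_opp !mulNrn.
by rewrite -!opprD !oppr_eq0.
Qed.

Lemma nd_rot (A : zmodType) (h a b : A) : torsion2 h ->
  nd h a b -> nd h b (- (a + b)).
Proof.
move=> t2; have h2 := torsion2_mul2 t2.
rewrite /nd -!andbA => /and5P[/eqP na /eqP nb /eqP nc /eqP nah /and5P[/eqP nbh /eqP nch /eqP ne /eqP n1 /eqP n2]].
apply/and5P; split; first by apply/eqP.
- by apply/eqP => e; apply: nc; zby e.
- by apply/eqP => e; apply: na; zby e.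
- by apply/eqP.
- apply/and5P; split; apply/eqP => e;
  [ by apply: nch; zby2 e h2 | by apply: nah; zby2 e h2 | by apply: n2; zby e
  | by apply: ne; zby e | by apply: n1; zby e ].
Qed.

Lemma nd_flip (A : zmodType) (h a b : A) : torsion2 h -> nd h a b ->
  [&& a - b != h, a *+ 2 != b & b *+ 2 != a] -> nd h (- a) b.
Proof.
move=> t2; have h2 := torsion2_mul2 t2.
rewrite /nd -!andbA => /and5P[/eqP na /eqP nb /eqP nc /eqP nah /and5P[/eqP nbh /eqP nch /eqP ne /eqP n1 /eqP n2]].
case/and3P => /eqP f1 /eqP f2 /eqP f3.
apply/and5P; split; try apply/and5P; try split; apply/eqP => e;
 first [by apply: na; zany2 e h2 | by apply: nb; zany2 e h2 | by apply: nc; zany2 e h2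
  | by apply: ne; zany2 e h2 | by apply: f1; zany2 e h2 | by apply: f2; zany2 e h2
  | by apply: f3; zany2 e h2 | by apply: nah; zany2 e h2 | by apply: nbh; zany2 e h2].
Qed.

Section SystemOfSelector.

Variables (A : finZmodType) (h : A) (m : A -> A -> bool).
Hypotheses (t2 : torsion2 h) (nh : h != 0) (t3 : torsion3_free A).
Hypothesis (sm : selector h [set: A] m).

Let good a b := nd h a b && m a b.

Let mC a b : m a b = m b a.
Proof. by case: sm => + _ _ _; apply; rewrite inE. Qed.

Let mN a b : m (- a) b = m a b.
Proof. by case: sm => _ + _ _; apply; rewrite inE. Qed.

Let goodC a b : good a b -> good b a.
Proof. by rewrite /good ndC mC. Qed.

Let goodN a b : good a b -> good (- a) b.
Proof.
case/andP => n mab; rewrite /good mN mab andbT; apply: nd_flip => //.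
by case: sm => _ _ _; apply; rewrite ?inE.
Qed.

Let goodNr a b : good a b -> good a (- b).
Proof. by move=> /goodC/goodN/goodC. Qed.

Definition is_block (B : {set A}) :=
  [exists q, exists a, exists b,
     (B == [set q; q + a; q + b; q + (a + b)]) && (nd h a b && m a b)]
  || [exists q, exists r,
     (B == [set q; q + h; q + r; q - r]) && (r *+ 2 != 0)].

Let is_blockP B :
  reflect ((exists q a b, B = [set q; q + a; q + b; q + (a + b)] /\ good a b) \/
           (exists q r, B = [set q; q + h; q + r; q - r] /\ r *+ 2 != 0))
          (is_block B).
Proof.
apply: (iffP orP) => [[]|[]].
- by case/existsP => q /existsP[a /existsP[b /andP[/eqP E g]]]; left; exists q, a, b.
- by case/existsP => q /existsP[r /andP[/eqP E g]]; right; exists q, r.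
- case=> q [a [b [-> g]]]; left.
  by apply/existsP; exists q; apply/existsP; exists a; apply/existsP; exists b; rewrite eqxx.
case=> q [r [-> g]]; right.
by apply/existsP; exists q; apply/existsP; exists r; rewrite eqxx.
Qed.

(** The base point is moved to each of the four points in turn. A parallelogram keeps its shape,
    since [good] is stable under signs; a forced block has one shape seen from [q] and [q + h] and
    another seen from [q + r] and [q - r]. *)
Let block_at B x : is_block B -> x \in B ->
  [\/ exists a b, B = [set x; x + a; x + b; x + (a + b)] /\ good a b,
      exists r, B = [set x; x + h; x + r; x - r] /\ r *+ 2 != 0
    | exists r, B = [set x; x + r; x + (r + h); x + r *+ 2] /\ r *+ 2 != 0].
Proof.
have h2 := torsion2_mul2 t2.
case/is_blockP => [[q [a [b [-> g]]]]|[q [r [-> g]]]]; rewrite !inE -!orbA => /or4P[] /eqP->.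
- by constructor 1; exists a, b.
- constructor 1; exists (- a), b; split; last exact: goodN.
  rewrite addrK (_ : q + a + b = q + (a + b)); last by zmod.
  rewrite (_ : q + a + (- a + b) = q + b); last by zmod.
  by set_perm.
- constructor 1; exists a, (- b); split; last exact: goodNr.
  rewrite addrK (_ : q + b + a = q + (a + b)); last by zmod.
  rewrite (_ : q + b + (a - b) = q + a); last by zmod.
  by set_perm.
- constructor 1; exists (- a), (- b); split; last exact/goodN/goodNr.
  rewrite (_ : q + (a + b) - a = q + b); last by zmod.
  rewrite (_ : q + (a + b) - b = q + a); last by zmod.
  rewrite (_ : q + (a + b) + (- a - b) = q); last by zmod.
  by set_perm.
- by constructor 2; exists r.
- constructor 2; exists (r + h); split; last by rewrite mulrnDl h2 addr0.
  rewrite (_ : q + h + h = q); last by zby h2.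
  rewrite (_ : q + h + (r + h) = q + r); last by zby h2.
  rewrite (_ : q + h - (r + h) = q - r); last by zmod.
  by set_perm.
- constructor 3; exists (- r); split; last by rewrite mulNrn oppr_eq0.
  rewrite addrK (_ : q + r + (- r + h) = q + h); last by zmod.
  rewrite (_ : q + r + - r *+ 2 = q - r); last by zmod.
  by set_perm.
- constructor 3; exists r; split => //.
  rewrite subrK (_ : q - r + (r + h) = q + h); last by zmod.
  rewrite (_ : q - r + r *+ 2 = q + r); last by zmod.
  by set_perm.
Qed.

Let completes u w d :=
  [\/ d = u + w /\ good u w, d = w - u /\ good u (w - u) | d = u - w /\ good w (u - w)]
  \/ deg4 h u w d.

Let block_complete B x u w : is_block B -> u != 0 -> w != 0 -> u != w ->
  x \in B -> x + u \in B -> x + w \in B ->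
  exists2 d, B = [set x; x + u; x + w; x + d] & completes u w d.
Proof.
move=> BB nu nw nuw xB; have h2 := torsion2_mul2 t2.
have eqx c d : (x + c == x + d) = (c == d) by rewrite (inj_eq (addrI x)).
have eqx0 c : (x + c == x) = (c == 0) by rewrite -{2}[x]addr0 eqx.
have [[a [b [-> g]]]|[r [-> r2]]|[r [-> r2]]] := block_at BB xB;
  rewrite !inE -!orbA !eqx !eqx0 (negPf nu) (negPf nw) /= => /or3P[]/eqP eu /or3P[]/eqP ew;
  move: nuw; rewrite eu ew ?eqxx // => _.
- exists (a + b); last by left; constructor 1.
  by set_perm.
- exists b; first by set_perm.
  have e : a + b - a = b by zmod.
  by left; constructor 2; rewrite e.
- exists (a + b); first by set_perm.
  by left; constructor 1; rewrite [a + b]addrC; split=> //; apply: goodC.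
- exists a; first by set_perm.
  by left; constructor 2; rewrite addrK; split=> //; apply: goodC.
- exists b; first by set_perm.
  have e : a + b - a = b by zmod.
  by left; constructor 3; rewrite e.
- exists a; first by set_perm.
  by left; constructor 3; rewrite addrK; split=> //; apply: goodC.
- exists (- r); first by set_perm.
  by right; left; constructor 1.
- exists r; first by set_perm.
  by right; left; constructor 1; rewrite opprK.
- exists (- r); first by set_perm.
  by right; left; constructor 2.
- exists h; first by set_perm.
  by right; left; constructor 3; rewrite subrr.
- exists r; first by set_perm.
  by right; left; constructor 2; rewrite opprK.
- exists h; first by set_perm.
  by right; left; constructor 3; rewrite addNr.
- exists (r *+ 2); first by set_perm.
  by right; right; constructor 1.
- exists (r + h); first by set_perm.
  by right; right; constructor 2.
- exists (r *+ 2); first by set_perm.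
  by right; right; constructor 1; split; zby h2.
- exists r; first by set_perm.
  by right; right; constructor 2; split; zby h2.
- exists (r + h); first by set_perm.
  by right; right; constructor 3.
- exists r; first by set_perm.
  by right; right; constructor 3; split; zby h2.
Qed.

Let one3_sub u w : nd h u (w - u) -> one3 (m u (w - u)) (m u w) (m w (u - w)).
Proof.
move=> n; case: sm => _ _ + _ => /(_ u (w - u)); rewrite !inE => /(_ isT isT n).
have -> : u + (w - u) = w by zmod.
by rewrite -[u - w]opprB [m w _]mC mN.
Qed.

Let good_nd u w : good u w -> nd h u (w - u).
Proof.
move=> g; have /goodN/andP[n _] := g.
rewrite -ndNN // ndC opprB; have := nd_rot t2 n.
have -> : - (- u + w) = u - w by zmod.
move=> /(nd_rot t2); have -> : - (w + (u - w)) = - u by zmod.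
by [].
Qed.

(** Each parallelogram alternative makes the triple nondegenerate, so it cannot coexist with [deg4].
    Among the three, [one3_sub] allows only one; within [deg4] the fourth point is unique by
    [deg4_inj]. *)
Let completes_inj u w d d' : u != 0 -> w != 0 -> u != w ->
  completes u w d -> completes u w d' -> d = d'.
Proof.
move=> nu nw nuw.
have c_nd e : [\/ e = u + w /\ good u w, e = w - u /\ good u (w - u)
    | e = u - w /\ good w (u - w)] -> nd h u (w - u).
  case=> -[_ g]; first exact: good_nd.
    by case/andP: g.
  case/andP: g => g _; have := nd_rot t2 g.
  have -> : w + (u - w) = u by zmod.
  by rewrite -ndNN // opprK opprB ndC.
case=> [c|D] [c'|D'].
- have := one3_sub (c_nd _ c); rewrite /one3.
  case: c c' => -[-> /andP[_ m1]] [] [-> /andP[_ m2]] //; rewrite m1 m2 //;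
  by case: (m _ _).
- by have := deg4_nd t2 D'; rewrite (c_nd _ c).
- by have := deg4_nd t2 D; rewrite (c_nd _ c').
- exact: deg4_inj D D'.
Qed.

Let completes_ex u w : u != 0 -> w != 0 -> u != w ->
  exists2 d, completes u w d & forall x : A, is_block [set x; x + u; x + w; x + d].
Proof.
move=> nu nw nuw; have h2 := torsion2_mul2 t2.
have [n|n] := boolP (nd h u (w - u)).
  have : [|| m u (w - u), m u w | m w (u - w)].
    by have := one3_sub n; rewrite /one3; do 3!case: (m _ _).
  case/or3P => mm.
  - have g : good u (w - u) by rewrite /good n.
    exists (w - u); first by left; constructor 2.
    move=> x; apply/is_blockP; left; exists x, u, (w - u); split => //.
    have -> : u + (w - u) = w by zmod.
    by set_perm.
  - have g : good u w.
      suff /goodNr : good u (- w) by rewrite opprK.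
      rewrite /good mC mN mC mm andbT.
      have := nd_rot t2 n; rewrite (_ : u + (w - u) = w); last by zmod.
      move=> /(nd_rot t2); rewrite (_ : - (w - u - w) = u); last by zmod.
      by rewrite ndC.
    exists (u + w); first by left; constructor 1.
    by move=> x; apply/is_blockP; left; exists x, u, w; split.
  - have g : good w (u - w).
      rewrite /good mm andbT; have := nd_rot t2 n.
      have -> : u + (w - u) = w by zmod.
      by rewrite -ndNN // opprK opprB ndC.
    exists (u - w); first by left; constructor 3.
    move=> x; apply/is_blockP; left; exists x, w, (u - w); split => //.
    have -> : w + (u - w) = u by zmod.
    by set_perm.
have [d D] := nd_deg4 t2 nu nw nuw n; exists d; first by right.
move=> x; apply/is_blockP; right.
have dbl (y : A) : y != 0 -> y != h -> y *+ 2 != 0 by rewrite t2 negb_or => -> ->.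
case: D => [][][e ->].
- have nwh : w != h by rewrite -e eq_sym.
  by exists x, w; split; [rewrite e | apply: dbl].
- have nuh : u != h by rewrite -e.
  by exists x, u; split; [rewrite e; set_perm | apply: dbl].
- exists x, u; split.
    have -> : w = - u by zby e.
    by set_perm.
  apply: dbl => //; apply/eqP => uh; case/eqP: nuw; zany3 e uh h2.
- exists (x + u), u; split.
    rewrite e addrK; have -> : x + u + u = x + u *+ 2 by zmod.
    have -> : x + u + h = x + (u + h) by zmod.
    by set_perm.
  by apply: dbl => //; apply/eqP => uh; case/eqP: nw; zany3 e uh h2.
- exists (x + u), u; split.
    rewrite e addrK; have -> : x + u + u = x + u *+ 2 by zmod.
    have -> : x + u + h = x + (u + h) by zmod.
    by set_perm.
  by apply: dbl => //; apply/eqP => uh; case/eqP: nw; zany3 e uh h2.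
- exists (x + w), w; split.
    rewrite e addrK; have -> : x + w + w = x + w *+ 2 by zmod.
    have -> : x + w + h = x + (w + h) by zmod.
    by set_perm.
  by apply: dbl => //; apply/eqP => uh; case/eqP: nu; zany3 e uh h2.
Qed.

Let block_card4 B : is_block B -> #|B| = 4%N.
Proof.
have h2 := torsion2_mul2 t2.
case/is_blockP => [[q [a [b [-> /andP[n _]]]]]|[q [r [-> /eqP r2]]]];
  apply/eqP; rewrite set4_uniq /= !inE !negb_or andbT -!andbA.
  move: n; rewrite /nd -!andbA => /and5P[/eqP na /eqP nb /eqP nc /eqP nah /and5P[/eqP nbh /eqP nch /eqP ne _ _]].
  apply/and5P; split; try apply/andP; try split; apply/eqP => e;
  by [ apply: na; zby e | apply: nb; zby e | apply: nc; zby e | apply: ne; zby e ].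
apply/and5P; split; try apply/andP; try split; apply/eqP => e;
by [ case/eqP: nh; zby e | apply: r2; zany2 e h2 ].
Qed.

Let block_sym4 B : is_block B -> symmetric_set B.
Proof.
have h2 := torsion2_mul2 t2.
case/is_blockP => [[q [a [b [-> g]]]]|[q [r [-> r2]]]].
  exists (q *+ 2 + (a + b)); rewrite imset_set4.
  have -> : - q + (q *+ 2 + (a + b)) = q + (a + b) by zmod.
  have -> : - (q + a) + (q *+ 2 + (a + b)) = q + b by zmod.
  have -> : - (q + b) + (q *+ 2 + (a + b)) = q + a by zmod.
  have -> : - (q + (a + b)) + (q *+ 2 + (a + b)) = q by zmod.
  by set_perm.
exists (q *+ 2); rewrite imset_set4.
have -> : - q + q *+ 2 = q by zmod.
have -> : - (q + h) + q *+ 2 = q + h by zby h2.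
have -> : - (q + r) + q *+ 2 = q - r by zmod.
have -> : - (q - r) + q *+ 2 = q + r by zmod.
by set_perm.
Qed.

Let block_hat B (s : {perm A}) : s \in hat A -> is_block B -> is_block (s @: B).
Proof.
have h2 := torsion2_mul2 t2.
case/hatP => e [c Es] /is_blockP BB; apply/is_blockP.
case: BB => [[q [a [b [-> g]]]]|[q [r [-> r2]]]]; [left|right]; rewrite imset_set4 !Es; case: e {Es}.
- exists (- q + c), (- a), (- b); split; last exact/goodN/goodNr.
  by congr [set _; _; _; _]; zmod.
- exists (q + c), a, b; split=> //.
  by congr [set _; _; _; _]; zmod.
- exists (- q + c), (- r); split; last by rewrite mulNrn oppr_eq0.
  by congr [set _; _; _; _]; first [zmod | zby h2].
exists (q + c), r; split=> //.
by congr [set _; _; _; _]; zmod.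
Qed.

Lemma system_of_selector : has_reversible_SQS A.
Proof.
exists [set B | is_block B]; split; first split.
- by move=> B; rewrite inE => /block_card4.
- move=> T /set3_of_card[x [y [z [uT ->]]]].
  have [u Ey] : exists u, y = x + u by exists (y - x); zmod.
  have [w Ez] : exists w, z = x + w by exists (z - x); zmod.
  subst y z; move: uT; rewrite /= !inE negb_or andbT => /andP[/andP[xu xw] uw].
  have nu : u != 0 by apply: contra_neq xu => ->; rewrite addr0.
  have nw : w != 0 by apply: contra_neq xw => ->; rewrite addr0.
  have nuw : u != w by apply: contra_neq uw => ->.
  have [d cd bd] := completes_ex nu nw nuw.
  exists [set x; x + u; x + w; x + d]; split; first by rewrite inE bd subsetUl.
  move=> B []; rewrite inE => bB /subsetP sub.
  have [||| d' EB cd'] := block_complete (x := x) bB nu nw nuw.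
  - by apply: sub; rewrite !inE eqxx.
  - by apply: sub; rewrite !inE eqxx orbT.
  - by apply: sub; rewrite !inE eqxx !orbT.
  by rewrite EB (completes_inj nu nw nuw cd cd').
- by move=> B; rewrite inE => /block_sym4.
- apply/actsP => s sA B; rewrite !inE /= /setact; apply/idP/idP; last exact: block_hat.
  have sV : (s^-1)%g \in hat A by rewrite groupV.
  move/(block_hat sV); congr (is_true (is_block _)).
  rewrite -imset_comp -[RHS]imset_id; apply: eq_imset => i /=.
  by rewrite /aperm permK.
Qed.

End SystemOfSelector.

(** An injective morphism sends elements outside {0, hB} to elements outside {0, hA}, because it
    reflects 2-torsion; hence it preserves [nd], and [m] can be pulled back. *)
Lemma selector_comap (A B : finZmodType) (hA : A) (hB : B) (f : B -> A)
    (m : A -> A -> bool) :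
  {morph f : x y / x + y} -> injective f -> torsion2 hA -> torsion2 hB ->
  selector hA [set: A] m -> selector hB [set: B] (fun a b => m (f a) (f b)).
Proof.
move=> fD finj tA tB [mC mN m1 mG]; have h2 := torsion2_mul2 tA.
have f0 : f 0 = 0 by have := fD 0 0; rewrite addr0 => e; zby e.
have fN x : f (- x) = - f x.
  by have := fD x (- x); rewrite subrr f0 => e; zby e.
have f2 x : f (x *+ 2) = f x *+ 2 by rewrite !mulr2n fD.
have f_eq0 x : (f x == 0) = (x == 0) by rewrite -f0 (inj_eq finj).
have f_h x : x != 0 -> x != hB -> f x != hA.
  move=> nx nxh; apply/eqP => e; have := tB x.
  by rewrite (negPf nx) (negPf nxh) -f_eq0 f2 e h2 eqxx.
have f_nd a b : nd hB a b -> nd hA (f a) (f b).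
  rewrite /nd -!fD -!f2 -!fD !f_eq0 (inj_eq finj).
  case/and4P => /and5P[na nb nc nah /andP[nbh nch]] -> -> ->.
  by rewrite na nb nc !f_h.
split=> [a b _ _|a b _ _|a b _ _ n|a b _ _ n mab].
- by rewrite mC ?inE.
- by rewrite fN mN ?inE.
- by rewrite fD; apply: m1; rewrite ?inE ?f_nd.
- have := mG (f a) (f b); rewrite !inE => /(_ isT isT (f_nd _ _ n) mab).
  rewrite -!f2 !(inj_eq finj) -fN -fD => /and3P[nh -> ->]; rewrite !andbT.
  have := n; rewrite /nd => /and4P[_ nab _ _].
  apply: contra nh => /eqP e; rewrite e.
  (* For [hB = 0] the source has no involution and [a - b = hB] contradicts [a != b]; otherwise
     [f hB] is a nonzero 2-torsion element, that is [hA]. *)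
  have [/eqP hB0|nhB] := boolP (hB == 0).
    by case/eqP: nab; have e' := e; rewrite hB0 in e'; zby e'.
  have : f hB *+ 2 == 0 by rewrite -f2 (torsion2_mul2 tB) f0.
  by rewrite tA f_eq0 (negPf nhB).
Qed.

Lemma card_halve (T : finType) (X : {set T}) (f : T -> T) (P : pred T) :
  injective f -> {in X, forall x, f x \in X} -> {in X, forall x, P (f x) = ~~ P x} ->
  #|X| = (2 * #|[set x in X | P x]|)%N.
Proof.
move=> finj fX fP.
have sub : f @: [set x in X | P x] \subset [set x in X | ~~ P x].
  apply/subsetP => _ /imsetP[x + ->]; rewrite !inE => /andP[xX Px].
  by rewrite fX // fP // Px.
have sub' : f @: [set x in X | ~~ P x] \subset [set x in X | P x].
  apply/subsetP => _ /imsetP[x + ->]; rewrite !inE => /andP[xX Px].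
  by rewrite fX // fP // Px.
have := subset_leq_card sub; have := subset_leq_card sub'.
rewrite !card_imset // => le1 le2.
have eq_half : #|[set x in X | ~~ P x]| = #|[set x in X | P x]|.
  by apply/eqP; rewrite eqn_leq le1 le2.
rewrite mul2n -addnn -{2}eq_half -(cardsID [set x | P x] X).
by congr (_ + _)%N; apply: eq_card => x; rewrite !inE // andbC.
Qed.

Lemma Fp_natr_eq0 p n : prime p -> ((n%:R : 'F_p) == 0) = (p %| n)%N.
Proof. by move=> pp; rewrite (dvdn_pcharf (pchar_Fp pp)). Qed.

Lemma Fp_val_lt p (x : 'F_p) : prime p -> (x < p)%N.
Proof. by move=> pp; rewrite -[X in (_ < X)%N](Fp_cast pp) ltn_ord. Qed.

Lemma Fp_valN p (x : 'F_p) : prime p -> x != 0 -> (- x : 'F_p) = (p - x)%N :> nat.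
Proof.
move=> pp nx; have x0 : (0 < x)%N by rewrite lt0n; apply: contra nx => /eqP e; apply/eqP/val_inj.
have lt := Fp_val_lt x pp.
have -> : - x = (p - x)%:R.
  by rewrite natrB ?(ltnW lt) // pchar_Fp_0 // natr_Zp sub0r.
by rewrite val_Fp_nat // modn_small //; lia.
Qed.

Lemma Fp_torsion2 p : prime p -> odd p -> torsion2 (0 : 'F_p).
Proof.
move=> pp op x; rewrite orbb -mulr_natr mulf_eq0 Fp_natr_eq0 //.
by rewrite (dvdn_prime2 pp) //; rewrite (_ : (p == 2)%N = false) ?orbF //; apply/eqP => e; rewrite e in op.
Qed.

(** * Selectors on the prime field *)

Section Count.

Variables (p : nat) (m : 'F_p -> 'F_p -> bool).
Hypotheses (pp : prime p) (p5 : (5 <= p)%N) (sm : selector 0 [set: 'F_p] m).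

Let op : odd p.
Proof. by case: (even_prime pp) => // p2; move: p5; rewrite p2. Qed.

Let F := 'F_p.
Let t2 := Fp_torsion2 pp op.
Let n0 k : (0 < k < 5)%N -> (k%:R : F) != 0.
Proof.
move=> /andP[k0 k5]; rewrite Fp_natr_eq0 //; apply/negP => /(dvdn_leq k0); lia.
Qed.

Let N := [set ab : F * F | nd 0 ab.1 ab.2].
Let X := [set ab in N | m ab.1 ab.2].

Let card_N : #|N| = ((p - 1) * (p - 5))%N.
Proof.
have row (a : F) : a != 0 -> #|[set b | nd 0 a b]| = (p - 5)%N.
  move=> na.
  have nak k : (0 < k < 5)%N -> a *+ k <> 0.
    by move=> /n0 nk; apply/eqP; rewrite -mulr_natr mulf_neq0.
  have a1 : a <> 0 := nak 1%N isT; have a2 := nak 2%N isT; have a3 := nak 3%N isT.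
  have [d hd] : exists d : F, d *+ 2 = - a.
    by exists (- a / 2%:R); rewrite -[LHS]mulr_natr divfK // n0.
  (* The five values of [b] excluded for a given [a]; [d] is -a/2. They are distinct because [a],
     [a *+ 2] and [a *+ 3] are nonzero. *)
  pose s := [:: 0; - a; a; - a *+ 2; d].
  have us : uniq s.
    rewrite !cons_uniq !inE !negb_or -!andbA; do !(apply/andP; split) => //;
    apply/eqP => e;
    by [apply: a1; zany2 e hd | apply: a2; zany2 e hd | apply: a3; zany2 e hd].
  have -> : [set b | nd 0 a b] = [set b | b \notin s].
    apply/setP => b; rewrite !inE /nd -!andbA na /=.
    have -> : (b == d) = (a + b *+ 2 == 0).
      apply/eqP/eqP => e; first by rewrite e hd subrr.
      apply/eqP; rewrite -subr_eq0 -[_ == 0]orbb -(t2 (b - d)); apply/eqP.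
      by zby2 e hd.
    have -> : (b == - a *+ 2) = (a *+ 2 + b == 0).
      by apply/eqP/eqP => e; zby e.
    have -> : (b == - a) = (a + b == 0).
      by apply/eqP/eqP => e; zby e.
    rewrite [b == a]eq_sym !negb_or.
    by repeat match goal with |- context [?x == ?y] => case: (x == y) end.
  have := cardsC [set b | b \in s]; rewrite card_Fp //.
  have -> : #|[set b | b \in s]| = 5%N by rewrite cardsE (card_uniqP us).
  have -> : ~: [set b | b \in s] = [set b | b \notin s] by apply/setP => b; rewrite !inE.
  by move=> e; apply: (@addnI 5); rewrite e subnKC.
rewrite -sum1_card.
rewrite (eq_bigl (fun ab : F * F => predT ab.1 && nd 0 ab.1 ab.2)); last by move=> ab; rewrite inE.
rewrite -(pair_big_dep predT (fun a b => nd 0 a b) (fun _ _ => 1%N)) /=.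
rewrite (bigID (fun a : F => a == 0)) /= big_pred1_eq big1 ?add0n; last first.
  by move=> b; rewrite /nd eqxx.
rewrite (eq_bigr (fun=> (p - 5)%N)); last first.
  by move=> a na; rewrite -(row a na) -sum1_card; apply: eq_bigl => b; rewrite inE.
rewrite sum_nat_const; congr (_ * _)%N.
by rewrite (eq_card (B := predC1 (0 : F))) ?cardC1 ?card_Fp // subn1.
Qed.

(** The rotation [r] permutes [N], and exactly one of [ab], [r ab], [r (r ab)] is selected; summing
    this over [N] counts [X] three times. *)
Let card_X3 : (3 * #|X| = #|N|)%N.
Proof.
pose r (ab : F * F) := (ab.2, - (ab.1 + ab.2)).
have rN ab : (r ab \in N) = (ab \in N).
  case: ab => a b; rewrite !inE /=.
  apply/idP/idP => [/(nd_rot t2)/(nd_rot t2)|]; last exact: nd_rot.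
  have -> : - (b - (a + b)) = a by zmod.
  by have -> : - (- (a + b) + a) = b by zmod.
have rK : injective r.
  move=> [a b] [a' b']; rewrite /r /= => /eqP.
  by rewrite xpair_eqE => /andP[/eqP-> /eqP/oppr_inj/addIr->].
have sum_r (f : F * F -> nat) : \sum_(ab in N) f (r ab) = \sum_(ab in N) f ab.
  by rewrite [RHS](reindex_inj rK); apply: eq_bigl => ab; rewrite rN.
pose f ab : nat := m ab.1 ab.2.
have -> : #|X| = \sum_(ab in N) f ab.
  rewrite -sum1_card (eq_bigl (fun ab => (ab \in N) && m ab.1 ab.2)).
    by rewrite big_mkcondr; apply: eq_bigr => ab _; rewrite /f; case: (m _ _).
  by move=> ab; rewrite inE.
have s1 := sum_r f; have s2 := sum_r (fun ab => f (r ab)).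
rewrite -sum1_card mulSn mul2n -addnn -{2}s1 -{2}s1 -{2}s2 -!big_split; apply: eq_bigr => -[a b].
case: sm => mC mN m1 _; rewrite inE /= => n; rewrite /f /r /=.
have := m1 a b; rewrite !inE => /(_ isT isT n) /eqP <-.
have -> : - (b - (a + b)) = a by zmod.
rewrite addnA mN ?inE // [m (a + b) a]mC ?inE // [m b (- _)]mC ?inE // mN ?inE //.
by rewrite [m (a + b) b]mC ?inE // addnAC.
Qed.

(** Three successive halvings: by the sign of [a], by the sign of [b], where [p./2] separates x from
    -x, and by the swap of [a] and [b]. *)
Let card_X8 : exists k, (#|X| = 8 * k)%N.
Proof.
case: sm => mC mN _ mG.
have pE : p = (2 * p./2 + 1)%N by have := odd_double_half p; rewrite op; lia.
have Xnz ab : ab \in X -> [/\ ab.1 != 0, ab.2 != 0 & ab.1 != ab.2].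
  by rewrite !inE /nd => /andP[/and4P[/and3P[-> -> _] -> _ _] _].
have XN a b : (a, b) \in X -> (- a, b) \in X.
  rewrite !inE /= => /andP[n mab]; rewrite mN ?inE // mab andbT.
  by apply: nd_flip => //; apply: mG; rewrite ?inE.
have XC a b : (a, b) \in X -> (b, a) \in X.
  by rewrite !inE /= ndC mC ?inE.
have leN (a : F) : a != 0 -> (- a <= p./2)%N = ~~ (a <= p./2)%N.
  by move=> na; rewrite Fp_valN //; have := Fp_val_lt a pp; lia.
pose P1 (ab : F * F) := (ab.1 <= p./2)%N; pose P2 (ab : F * F) := (ab.2 <= p./2)%N.
pose P3 (ab : F * F) := (ab.1 < ab.2)%N.
rewrite (card_halve (f := fun ab : F * F => (- ab.1, ab.2)) (P := P1)); first last.
- by move=> [a b] /Xnz[na _ _]; apply: leN.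
- by move=> [a b]; apply: XN.
- by move=> [a b] [a' b'] /eqP; rewrite xpair_eqE eqr_opp -xpair_eqE => /eqP.
rewrite (card_halve (f := fun ab : F * F => (ab.1, - ab.2)) (P := P2)); first last.
- by move=> [a b] /setIdP[/Xnz[_ nb _] _]; apply: leN.
- by move=> [a b] /setIdP[abX Pa]; apply/setIdP; split=> //; apply/XC/XN/XC.
- by move=> [a b] [a' b'] /eqP; rewrite xpair_eqE eqr_opp -xpair_eqE => /eqP.
rewrite (card_halve (f := fun ab : F * F => (ab.2, ab.1)) (P := P3)); first last.
- move=> [a b] /setIdP[/setIdP[/Xnz[_ _ nab] _] _].
  rewrite /P3 /= -leqNgt ltn_neqAle (_ : (b == a :> nat) = false) //.
  by apply: contra_neqF nab => /eqP e; apply/esym/val_inj.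
- move=> [a b] /setIdP[/setIdP[abX Pa] Pb].
  by apply/setIdP; split; first by apply/setIdP; split; first exact: XC.
- by move=> [a b] [a' b'] [-> ->].
by eexists; rewrite !mulnA.
Qed.

(** For p = 3 mod 4 both p - 1 and p - 5 are twice an odd number, so their product is not divisible
    by 8. *)
Lemma selector_mod4 : (p %% 4 = 1)%N.
Proof.
have [k k8] := card_X8; have := card_X3; rewrite card_N k8 => e.
have [q pq] : exists q, p = (2 * q + 1)%N.
  by exists p./2; have := odd_double_half p; rewrite op; lia.
have [t qt] : exists t, q = (2 * t)%N \/ q = (2 * t + 1)%N.
  by exists q./2; have := odd_double_half q; case: (odd q); lia.
case: qt => qt; first by rewrite pq qt; lia.
have [t' tt'] : exists t', t = t'.+1 by exists t.-1; have := p5; lia.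
have e' : (3 * (8 * k) = (4 * t' + 6) * (4 * t' + 2))%N.
  by rewrite e; congr (_ * _)%N; lia.
by nia.
Qed.
End Count.

(** * Matching two paths with rungs *)

(* [outer_edge j s] selects the edge (j, s) -- (j + 1, s) on the outer path and
   [inner_edge k s] the edge (k, s) -- (k + 1, - s) on the inner path; index n
   is a loop.  The rungs of s in S sit at index n on both sides, and those of s
   in G at j0 on the outer path, of s in S at k0 on the inner one. *)
Section Pattern.

Variables (F : zmodType) (chi S G : F -> bool) (n j0 k0 : nat).
Hypotheses (n_even : ~~ odd n) (j0n : (0 < j0 < n)%N) (k0n : (0 < k0 < n)%N).
Hypothesis k0_odd : odd k0.
Hypothesis chiN : forall s, chi (- s) = chi s.
Hypothesis SG_cases : forall s, s != 0 ->
  (S (- s) = ~~ S s /\ [/\ G s = false, G (- s) = false & chi s]) \/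
  (G (- s) = ~~ G s /\ [/\ S s = false, S (- s) = false & chi s = false]).

Let c := odd j0.
(** [W] contains exactly one of [s] and [- s] for nonzero [s], which decides between the two edges
    at index 0. The sign under [G] compensates for the parity of [j0], so that the alternation meets
    the rungs there. *)
Let W s := S s || G (if c then - s else s).

Definition outer_edge j s :=
  if (j < j0)%N then odd j (+) W s
  else if (j < n)%N then c (+) odd j (+) S (if c then - s else s)
  else c && ~~ chi s.

Definition inner_edge k s :=
  if (k < k0)%N then odd k
  else if (k < n)%N then (if odd k then ~~ S s else S (- s))
  else false.

Lemma outer_exact i s : (0 < i <= n)%N -> s != 0 ->
  one3 (outer_edge i s) (outer_edge i.-1 s) (((i == n) && S s) || ((i == j0) && G s)).
Proof.
move=> i_n ns; case: i i_n => // i /= i_n.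
rewrite /outer_edge /W; have [ltj|gtj|ej] := ltngtP i.+1 j0.
- have -> : (i.+1 == n) = false by lia.
  by rewrite /=; case: (odd i); case: (_ || _).
- have [ltn|gtn|en] := ltngtP i.+1 n.
  + by rewrite /=; case: (odd i); case: c; case: (S _).
  + by lia.
  (* For squares the rung at [n] completes the alternation. For nonsquares there is no rung at [n],
     and the loop is taken exactly when [j0] is odd. *)
  + have -> : odd i by have := n_even; rewrite -en /= negbK.
    rewrite /=; case: (SG_cases ns) => -[e1 [e2 e3 e4]]; rewrite ?e1 ?e2 ?e3 e4;
    by case: c; rewrite ?e1 ?e2 ?e3; case: (S s).
- have -> : (i.+1 < n)%N by lia.
  have -> : (i.+1 == n) = false by lia.
  have ci : odd i = ~~ c by rewrite /c -ej /= negbK.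
  rewrite /= ci.
  case: (SG_cases ns) => -[e1 [e2 e3 e4]];
  by case: c; rewrite ?e1 ?e2 ?e3 ?opprK; case: (S s); case: (G s).
Qed.

Lemma outer_edge0 s : s != 0 -> outer_edge 0 (- s) = ~~ outer_edge 0 s.
Proof.
move=> ns; rewrite /outer_edge; have -> : (0 < j0)%N by lia.
rewrite /W /= opprK; case: (SG_cases ns) => -[e1 [e2 e3 e4]];
by case: c; rewrite ?e1 ?e2 ?e3; case: (S s); case: (G s).
Qed.

Lemma outer_edge_last s : outer_edge n (- s) = outer_edge n s.
Proof.
rewrite /outer_edge; have -> : (n < j0)%N = false by lia.
by rewrite ltnn chiN.
Qed.

(** The alternation starts with an unselected edge at 0. As [k0] is odd, the edge reaching [k0] from
    below is again unselected, so [k0] is covered by its rung if [S s] and by its next edge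
    otherwise. *)
Lemma inner_exact i s : (0 < i <= n)%N ->
  one3 (inner_edge i s) (inner_edge i.-1 (- s))
    (((i == n) && S (- s)) || ((i == k0) && S s)).
Proof.
case: i => // i /= i_n.
rewrite /inner_edge opprK; have [ltj|gtj|ej] := ltngtP i.+1 k0.
- have -> : (i.+1 == n) = false by lia.
  by rewrite /=; case: (odd i).
- have [ltn|gtn|en] := ltngtP i.+1 n.
  + by rewrite /=; case: (odd i); case: (S s); case: (S (- s)).
  + by lia.
  + have -> : odd i by have := n_even; rewrite -en /= negbK.
    by case: (S (- s)).
- have -> : (i.+1 < n)%N by lia.
  have -> : (i.+1 == n) = false by lia.
  have oi : odd i = false by apply/negbTE; have := k0_odd; rewrite -ej.
  by rewrite /= oi; case: (S s).
Qed.

Lemma inner_edge_last s : inner_edge n (- s) = inner_edge n s.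
Proof.
rewrite /inner_edge; have -> : (n < k0)%N = false by lia.
by rewrite ltnn.
Qed.

Lemma inner_edge0 s : inner_edge 0 s = false.
Proof. by rewrite /inner_edge; have -> : (0 < k0)%N by lia. Qed.

End Pattern.

(** * Quadratic residues and edge rules on the prime field *)

Section Base.

Variable p : nat.
Hypotheses (pp : prime p) (p4 : (p %% 4 = 1)%N).

Let F := 'F_p.
Let n := p./2.

Let pE : p = (2 * n + 1)%N.
Proof.
by rewrite /n; have := divn_eq p 4; rewrite p4; have := odd_double_half p; case: (odd p); lia.
Qed.

Let n_even : ~~ odd n.
Proof. by apply/negP => on; have := odd_double_half n; rewrite on; have := divn_eq p 4; rewrite p4; have := pE; lia. Qed.

Let n_gt1 : (1 < n)%N.
Proof. by have := p4; have := prime_gt1 pp; have := pE; lia. Qed.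

Let Fermat (s : F) : s != 0 -> s ^+ n = 1 \/ s ^+ n = - 1.
Proof.
move=> ns; have s0 : (0 < s)%N by rewrite lt0n; apply: contra_neq ns => e; apply/val_inj.
have cs : coprime s p.
  rewrite coprime_sym prime_coprime //; apply/negP => /(dvdn_leq s0).
  by rewrite leqNgt Fp_val_lt.
have e : s ^+ (p - 1) = 1.
  have := Euler_exp_totient cs; rewrite totient_prime // -subn1 => e.
  have := congr1 (fun k : nat => k%:R : F) e.
  by rewrite !Fp_nat_mod // natrX natr_Zp.
have : (s ^+ n) ^+ 2 = 1.
  by rewrite -exprM -[RHS]e; congr (_ ^+ _); have := pE; lia.
by move=> /eqP; rewrite sqrf_eq1 => /orP[]/eqP; [left|right].
Qed.

Let one_neqN1 : (1 : F) != - 1.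
Proof.
apply/eqP => e; have : (2%:R : F) == 0 by rewrite -[2%N]/(1 + 1)%N natrD {1}e addNr.
by rewrite Fp_natr_eq0 // => /dvdn_leq -/(_ isT); have := pE; have := n_gt1; lia.
Qed.

(** Euler's criterion for nonzero squares. Its invariance under sign reflects that -1 is a square
    for p = 1 mod 4. *)
Let chi (s : F) := s ^+ n == 1.

Let chiN s : chi (- s) = chi s.
Proof. by rewrite /chi exprNn -signr_odd (negPf n_even) expr0 mul1r. Qed.

Let chi_nz s : chi s -> s != 0.
Proof. by apply: contraTneq => ->; rewrite /chi expr0n eqn0Ngt (ltnW n_gt1) eq_sym oner_eq0. Qed.

Let chiF s : s != 0 -> chi s = false -> s ^+ n = - 1.
Proof. by move=> /Fermat[e|//]; rewrite /chi e eqxx. Qed.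

Let chi_div s t : s != 0 -> t != 0 -> chi t = false -> chi (s / t) = ~~ chi s.
Proof.
move=> ns nt ct; rewrite /chi expr_div_n (chiF nt ct).
by case: (Fermat ns) => ->; rewrite invrN invr1 mulrN1 ?opprK ?eqxx // eq_sym ?(negPf one_neqN1) // eq_sym.
Qed.

(** Otherwise all p - 1 = 2n nonzero elements would be roots of X^n - 1. *)
Let nonresidue : exists x : F, x != 0 /\ chi x = false.
Proof.
suff /existsP[x /andP[nx cx]] : [exists x : F, (x != 0) && ~~ chi x].
  by exists x; split=> //; apply: negbTE.
have [//|/existsPn all_chi] := boolP [exists x : F, (x != 0) && ~~ chi x].
exfalso.
have n0 : (0 < n)%N := ltnW n_gt1.
have roots : all n.-unity_root (enum (predC1 (0 : F))).
  apply/allP => x; rewrite mem_enum inE => nx; rewrite unity_rootE.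
  by have := all_chi x; rewrite negb_and nx negbK.
have := max_unity_roots n0 roots (enum_uniq _).
by rewrite -cardE cardC1 card_Fp //; have := pE; lia.
Qed.

Let odd_part i : (0 < i)%N -> exists a k, odd k /\ (i = 2 ^ a * k)%N.
Proof.
elim/ltn_ind: i => i IH i0; have [oi|ei] := boolP (odd i).
  by exists 0%N, i; rewrite mul1n.
have ih : i = (2 * i./2)%N by have := odd_double_half i; rewrite (negPf ei); lia.
have [||a [k [ok ik]]] := IH i./2; [by lia|by lia|].
by exists a.+1, k; rewrite expnS -mulnA -ik.
Qed.

Let natF_inj i j : (i < p)%N -> (j < p)%N -> ((i%:R : F) == j%:R) = (i == j).
Proof.
move=> ip jp; apply/eqP/eqP => [e|-> //].
by have := congr1 (@nat_of_ord _) e; rewrite /= !val_Fp_nat // !modn_small.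
Qed.

Let natF_opp i j : (0 < i <= n)%N -> (j <= n)%N -> ((i%:R : F) == - j%:R) = false.
Proof.
move=> /andP[i0 i_n] jn; rewrite -subr_eq0 opprK -natrD Fp_natr_eq0 //.
by apply/negP => /dvdn_leq; rewrite addn_gt0 i0 => /(_ isT); have := pE; lia.
Qed.

Let F_cases (j : F) : [\/ j = 0, exists i, (0 < i <= n)%N /\ j = i%:R
  | exists i, (0 < i <= n)%N /\ j = - i%:R].
Proof.
have [->|nj] := eqVneq j 0; first by constructor 1.
have j0 : (0 < j)%N by rewrite lt0n; apply: contra_neq nj => e; apply/val_inj.
have [le|gt] := leqP j n.
  by constructor 2; exists j; rewrite natr_Zp le j0.
constructor 3; exists (p - j)%N; have := Fp_val_lt j pp => lt.
rewrite natrB ?(ltnW lt) // pchar_Fp_0 // natr_Zp sub0r opprK; split=> //.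
by have := pE; lia.
Qed.

Let nat_nz i : (0 < i <= n)%N -> (i%:R : F) != 0.
Proof. by move=> i0; rewrite -[0]oppr0; apply/negbT/(natF_opp (j := 0)). Qed.

(* If 2 is a residue, the odd part of a nonresidue in [1, n] is a nonresidue. *)
Let k0_ex : exists k, [/\ odd k, (0 < k < n)%N & chi (2 * k)%:R = false].
Proof.
have [c2|c2] := boolP (chi 2%:R); last by exists 1%N; rewrite n_gt1 muln1; split=> //; apply: negbTE.
have [i [i0 ci]] : exists i, (0 < i <= n)%N /\ chi i%:R = false.
  have [x [nx cx]] := nonresidue.
  case: (F_cases x) => [x0|[i [i0 xi]]|[i [i0 xi]]]; first by rewrite x0 eqxx in nx.
    by exists i; rewrite -xi.
  by exists i; rewrite -chiN -xi.
have [a [k [ok ik]]] : exists a k, odd k /\ (i = 2 ^ a * k)%N by apply: odd_part; case/andP: i0.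
have k_n : (0 < k <= n)%N.
  by rewrite odd_gt0 //= (leq_trans _ (proj2 (andP i0))) // ik leq_pmull // expn_gt0.
exists k; split=> //.
  by case/andP: k_n => -> k_n /=; rewrite ltn_neqAle k_n andbT; apply: contraNneq n_even => <-.
move: ci; rewrite ik /chi !natrM natrX !exprMn -exprM mulnC exprM (eqP c2) expr1n.
by rewrite !mul1r.
Qed.

Let le_ltp i : (i <= n)%N -> (i < p)%N.
Proof. by have := pE; lia. Qed.

Let halfN (s : F) : s != 0 -> (- s <= n)%N = ~~ (s <= n)%N.
Proof. by move=> ns; rewrite Fp_valN //; have := Fp_val_lt s pp; have := pE; lia. Qed.

(** On representatives the reflection [- j - 1] is [p - 1 - j], with fixed index [n]. A rule on 0,
    ..., n is continued by it to the whole field; consistency at [n] only needs symmetry in [s]. *)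
Let ext (f : nat -> F -> bool) (j s : F) :=
  if (j <= n)%N then f j s else f (p - 1 - j)%N (- s).

Let ext_nat f i s : (i <= n)%N -> ext f i%:R s = f i s.
Proof.
by move=> i_n; rewrite /ext val_Fp_nat // modn_small ?i_n ?le_ltp.
Qed.

Let ext_sym f j s : (forall s, f n (- s) = f n s) -> ext f (- j - 1) (- s) = ext f j s.
Proof.
move=> fn; have lt := Fp_val_lt j pp.
have Ej : - j - 1 = (p - 1 - j)%:R :> F.
  by rewrite !natrB ?pchar_Fp_0 ?natr_Zp ?prime_gt0 //; [ring|lia].
have vj : (- j - 1 : F) = (p - 1 - j)%N :> nat.
  by rewrite Ej val_Fp_nat // modn_small //; have := pE; lia.
rewrite /ext vj opprK; have e : (p - 1 - (p - 1 - j) = j)%N by lia.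
rewrite e; have := pE; move: (nat_of_ord j) lt e => i lt _ e.
have [lt_in|gt_in|->] := ltngtP i n.
- by have -> : (p - 1 - i <= n)%N = false by lia.
- by have -> : (p - 1 - i <= n)%N by lia.
- have -> : (p - 1 - n = n)%N by lia.
  by rewrite leqnn fn.
Qed.

Let two_n : 2 * n%:R = - 1 :> F.
Proof.
apply/eqP; rewrite -subr_eq0 opprK -natrM natr1 Fp_natr_eq0 //.
by rewrite -addn1 -pE dvdnn.
Qed.

(* S is a half-system of the squares and G of the nonsquares, so that S and G,
   up to sign, together represent the nonzero elements modulo -1. *)
Section Construction.

Variables (k0 j0 : nat) (J g : F).
Hypotheses (k0_odd : odd k0) (k0n : (0 < k0 < n)%N) (k0_chi : chi (2 * k0)%:R = false).
Hypotheses (EJ : J = (4 * k0%:R)^-1) (j0_le : (0 < j0 <= n)%N).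
Hypothesis (Jg : J = j0%:R /\ g = (2 * k0)%:R \/ J = - j0%:R /\ g = - (2 * k0)%:R).

Let S s := chi s && (s <= n)%N.
Let G s := S (s / g).

(** A rung joins inner index k with outer index 1/(4k), the parameter s becoming 2ks. Thus [n] goes
    to [n], since 2n = -1, and [k0] goes to [J]; multiplication by the nonresidue 2k0 carries the
    squares in [S] to nonsquares. *)
Let PQ (j s : F) :=
  [|| (j == n%:R) && S s, (j == - n%:R) && S (- s),
      (j == J) && S (s / (2 * k0)%:R) | (j == - J) && S (- s / (2 * k0)%:R)].

Let k0_le : (0 < k0 <= n)%N.
Proof. by case/andP: k0n => -> /ltnW. Qed.

Let k0_nz : k0%:R != 0 :> F.
Proof. exact: nat_nz. Qed.

Let two_nz : (2 : F) != 0.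
Proof. by apply: (nat_nz (i := 2)); rewrite n_gt1. Qed.

Let two_k0 : (2 * k0)%:R != 0 :> F.
Proof. by rewrite natrM mulf_neq0. Qed.

Let four : (4 : F) = 2 * 2.
Proof. by rewrite -natrM. Qed.

Let four_nz : (4 : F) != 0.
Proof. by rewrite four mulf_neq0. Qed.

Let Jnz : J != 0.
Proof. by rewrite EJ invr_eq0 mulf_neq0. Qed.

Let chi1 : chi 1.
Proof. by rewrite /chi expr1n. Qed.

(** If [j0 = n] then 2J would be 1 or -1, and so would its inverse 2k0, which is a nonresidue. *)
Let j0n : (0 < j0 < n)%N.
Proof.
case/andP: j0_le => -> jn /=; rewrite ltn_neqAle jn andbT; apply/eqP => e.
have k2 : (2 * k0)%:R * (J * 2) = 1.
  have -> : J = ((2 * k0)%:R * 2)^-1 by rewrite EJ natrM four; congr _^-1; ring.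
  by rewrite invfM -mulrA mulVf // mulr1 divff.
have := k0_chi; case: Jg k2 => -[-> _]; rewrite e ?mulNr mulrC mulrC [n%:R * 2]mulrC two_n ?opprK.
  by rewrite mulrN1 => /(congr1 -%R); rewrite opprK => ->; rewrite chiN chi1.
by rewrite mulr1 => ->; rewrite chi1.
Qed.

Let g_nz : g != 0.
Proof. by case: Jg => -[_ ->]; rewrite ?oppr_eq0 two_k0. Qed.

Let g_chi : chi g = false.
Proof. by case: Jg => -[_ ->]; rewrite ?chiN k0_chi. Qed.

Let PQ_nat i s : (0 < i <= n)%N ->
  PQ i%:R s = ((i == n) && S s) || ((i == j0) && G s).
Proof.
move=> i_n; have ip : (i < p)%N by case/andP: i_n => _ /le_ltp.
have np : (n < p)%N by apply: le_ltp.
have jn : (j0 <= n)%N by case/andP: j0_le.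
have jp : (j0 < p)%N by apply: le_ltp.
rewrite /PQ natF_inj // natF_opp //= /G.
case: Jg => -[-> ->]; first by rewrite natF_inj // natF_opp //= orbF.
by rewrite opprK natF_opp // natF_inj //= invrN mulrN mulNr.
Qed.

Let S_opp s : chi s -> S (- s) = ~~ S s.
Proof. by move=> cs; rewrite /S chiN cs /= halfN ?chi_nz. Qed.

Let G_opp s : s != 0 -> chi s = false -> G (- s) = ~~ G s.
Proof. by move=> ns cs; rewrite /G mulNr S_opp // chi_div ?g_nz ?g_chi // cs. Qed.

Let S_chi s : chi s = false -> S s = false.
Proof. by rewrite /S => ->. Qed.

Let G_chi s : s != 0 -> chi s -> G s = false.
Proof. by move=> ns cs; rewrite /G S_chi // chi_div ?g_nz ?g_chi // cs. Qed.

Let SG_cases s : s != 0 ->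
  (S (- s) = ~~ S s /\ [/\ G s = false, G (- s) = false & chi s]) \/
  (G (- s) = ~~ G s /\ [/\ S s = false, S (- s) = false & chi s = false]).
Proof.
move=> ns; have [cs|/negbTE cs] := boolP (chi s); [left|right].
  by rewrite S_opp ?G_chi ?oppr_eq0 ?chiN.
by rewrite G_opp ?S_chi ?chiN.
Qed.

Let PQ_opp j s : PQ (- j) (- s) = PQ j s.
Proof.
rewrite /PQ !eqr_opp !opprK [- j == n%:R]eqr_oppLR [- j == J]eqr_oppLR orbCA.
by congr [|| _, _ | _]; rewrite orbC.
Qed.

Let PQ_inv i s : (0 < i <= n)%N ->
  PQ (4 * i%:R)^-1 (2 * i%:R * s) = ((i == n) && S (- s)) || ((i == k0) && S s).
Proof.
move=> i_n; have ip : (i < p)%N by case/andP: i_n => _ /le_ltp.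
have kn : (k0 <= n)%N by case/andP: k0_le.
have kp : (k0 < p)%N by apply: le_ltp.
have np : (n < p)%N by apply: le_ltp.
have ni := nat_nz i_n.
have n4 : 4 * i%:R != 0 :> F by rewrite mulf_neq0.
have eqV (y : F) : ((4 * i%:R)^-1 == y) = (4 * i%:R * y == 1).
  by rewrite -(inj_eq (mulfI n4)) divff // eq_sym.
have one_n : (1 : F) = - (2 * n%:R) by rewrite two_n opprK.
have En : ((4 * i%:R)^-1 == n%:R :> F) = (i == n).
  rewrite eqV (_ : 4 * i%:R * n%:R = - (2 * i%:R)).
    by rewrite [X in _ == X]one_n eqr_opp (inj_eq (mulfI two_nz)) natF_inj.
  have -> : 4 * i%:R * n%:R = (2 * i%:R) * (2 * n%:R) :> F by rewrite four; ring.
  by rewrite two_n mulrN1.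
have EnN : ((4 * i%:R)^-1 == - n%:R :> F) = false.
  rewrite eqV (_ : 4 * i%:R * - n%:R = 2 * i%:R).
    by rewrite [X in _ == X]one_n -mulrN (inj_eq (mulfI two_nz)) natF_opp.
  have -> : 4 * i%:R * - n%:R = - ((2 * i%:R) * (2 * n%:R)) :> F by rewrite four; ring.
  by rewrite two_n mulrN1 opprK.
have EJp : ((4 * i%:R)^-1 == J) = (i == k0).
  rewrite EJ (inj_eq invr_inj) (inj_eq (mulfI four_nz)) natF_inj //.
have EJN : ((4 * i%:R)^-1 == - J) = false.
  rewrite EJ -invrN (inj_eq invr_inj) -mulrN (inj_eq (mulfI four_nz)) natF_opp //.
rewrite /PQ En EnN EJp EJN /= orbF.
congr (_ || _); first by case: eqP => //= ->; rewrite two_n mulN1r.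
case: eqP => //= ->; congr (S _).
by rewrite natrM mulrAC divff ?mul1r //  -natrM.
Qed.

(** [PP], [QQ] and [PQ] select outer edges, inner edges and rungs. The inner rule omits index 0,
    which stands for equal representatives [u = w] in [mixed_rule2_exact]. *)
Lemma edge_rules_construction : exists PP QQ PQ : 'F_p -> 'F_p -> bool,
  [/\ forall j s, PP (- j - 1) (- s) = PP j s,
      forall k s, QQ (- k - 1) (- s) = QQ k s
    & forall j s, PQ (- j) (- s) = PQ j s] /\
  [/\ forall j s, s != 0 -> one3 (PP j s) (PP (j - 1) s) (PQ j s),
      forall s, PQ 0 s = false,
      forall s, QQ 0 s = false
    & forall k s, k != 0 -> s != 0 ->
        one3 (QQ k s) (QQ (k - 1) (- s)) (PQ (4 * k)^-1 (2 * k * s))].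
Proof.
have PQ0 s : PQ 0 s = false.
  rewrite /PQ eq_sym [0 == - n%:R]eq_sym [0 == J]eq_sym [0 == - J]eq_sym !oppr_eq0.
  by rewrite (negPf Jnz) (negPf (nat_nz _)) // leqnn (ltnW n_gt1).
pose P1 := outer_edge chi S G n j0; pose Q1 := inner_edge S n k0.
have P1_n (s : F) : P1 n (- s) = P1 n s by exact: (outer_edge_last S G n_even j0n k0n k0_odd chiN).
have Q1_n (s : F) : Q1 n (- s) = Q1 n s by exact: (inner_edge_last S n_even j0n k0n k0_odd).
have P1_exact i s : (0 < i <= n)%N -> s != 0 -> one3 (P1 i s) (P1 i.-1 s) (PQ i%:R s).
  by move=> i_n ns; rewrite PQ_nat //; apply: (outer_exact n_even j0n k0n k0_odd SG_cases).
have Q1_exact i s : (0 < i <= n)%N -> s != 0 ->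
    one3 (Q1 i s) (Q1 i.-1 (- s)) (PQ (4 * i%:R)^-1 (2 * i%:R * s)).
  by move=> i_n ns; rewrite PQ_inv //; apply: (inner_exact S n_even j0n k0n k0_odd).
exists (ext P1), (ext Q1), PQ; split; split.
- by move=> j s; apply/ext_sym/P1_n.
- by move=> j s; apply/ext_sym/Q1_n.
- exact: PQ_opp.
- move=> j s ns; case: (F_cases j) => [->|[i [i_n ->]]|[i [i_n ->]]].
  (* Index 0 carries no rung, and the symmetry turns the edge at -1 with parameter [s] into the edge
     at 0 with parameter [- s]. *)
  + have P1_0 (t : F) : t != 0 -> P1 0 (- t) = ~~ P1 0 t by exact: (outer_edge0 n_even j0n k0n k0_odd SG_cases).
    rewrite PQ0 -[ext P1 (0 - 1) s](ext_sym _ _ P1_n) opprB subr0 addrN.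
    by rewrite !(ext_nat _ _ (leq0n _)) P1_0 //; case: (P1 0 s).
  + have := P1_exact _ _ i_n ns; case: i i_n => // i i_n.
    have -> : i.+1%:R - 1 = i%:R :> F by rewrite -natr1 addrK.
    by rewrite !ext_nat //; case/andP: i_n => // _ /ltnW.
  (* The symmetry reduces index -i to index i, exchanging its two edges and the sign of [s]. *)
  + rewrite -[ext P1 (- i%:R) s](ext_sym _ _ P1_n).
    rewrite -[ext P1 (_ - 1) s](ext_sym _ _ P1_n) -PQ_opp opprB !opprK.
    have -> : 1 + i%:R - 1 = i%:R :> F by ring.
    have ns' : - s != 0 by rewrite oppr_eq0.
    have := P1_exact _ _ i_n ns'; rewrite one3_swap12; case: i i_n => // i i_n.
    have -> : i.+1%:R - 1 = i%:R :> F by rewrite -natr1 addrK.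
    by rewrite !ext_nat //; case/andP: i_n => // _ /ltnW.
- exact: PQ0.
- move=> s; rewrite (ext_nat _ _ (leq0n _)).
  exact: (inner_edge0 S n_even j0n k0n k0_odd).
move=> k s nk ns; case: (F_cases k) => [k_0|[i [i_n ->]]|[i [i_n ->]]].
- by rewrite k_0 eqxx in nk.
- have := Q1_exact _ _ i_n ns; case: i i_n => // i i_n.
  have -> : i.+1%:R - 1 = i%:R :> F by rewrite -natr1 addrK.
  by rewrite !ext_nat //; case/andP: i_n => // _ /ltnW.
rewrite -[ext Q1 (_ - 1) (- s)](ext_sym _ _ Q1_n).
rewrite -[ext Q1 (- i%:R) s](ext_sym _ _ Q1_n) -PQ_opp opprB !opprK.
have -> : 1 + i%:R - 1 = i%:R :> F by ring.
have -> : - (4 * - i%:R)^-1 = (4 * i%:R)^-1 :> F by rewrite mulrN invrN opprK.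
have -> : - (2 * - i%:R * s) = 2 * i%:R * s by ring.
have := Q1_exact _ _ i_n ns; rewrite one3_swap12; case: i i_n => // i i_n.
have -> : i.+1%:R - 1 = i%:R :> F by rewrite -natr1 addrK.
by rewrite !ext_nat //; case/andP: i_n => // _ /ltnW.
Qed.

End Construction.

Lemma edge_rules_exist : exists PP QQ PQ : 'F_p -> 'F_p -> bool,
  [/\ forall j s, PP (- j - 1) (- s) = PP j s,
      forall k s, QQ (- k - 1) (- s) = QQ k s
    & forall j s, PQ (- j) (- s) = PQ j s] /\
  [/\ forall j s, s != 0 -> one3 (PP j s) (PP (j - 1) s) (PQ j s),
      forall s, PQ 0 s = false,
      forall s, QQ 0 s = false
    & forall k s, k != 0 -> s != 0 ->
        one3 (QQ k s) (QQ (k - 1) (- s)) (PQ (4 * k)^-1 (2 * k * s))].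
Proof.
have [k0 [o k c]] := k0_ex.
have k0_le : (0 < k0 <= n)%N by case/andP: k => -> /ltnW.
have [e|[j [j_le e]]|[j [j_le e]]] := F_cases (4 * k0%:R)^-1.
- have := nat_nz k0_le; have := nat_nz (i := 2); rewrite n_gt1 => /(_ isT) n2 nk.
  by move/eqP: e; rewrite invr_eq0 (natrM _ 2 2) !mulf_eq0 (negPf n2) (negPf nk).
- exact: (edge_rules_construction o k c (erefl _) j_le (or_introl (conj e (erefl _)))).
exact: (edge_rules_construction o k c (erefl _) j_le (or_intror (conj e (erefl _)))).
Qed.

End Base.

(** * Extending a selector to an overgroup of prime index *)

Section FpRules.

Variables (p : nat) (m0 PP QQ PQ : 'F_p -> 'F_p -> bool).
Hypotheses (pp : prime p) (p5 : (5 <= p)%N).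
Hypothesis sm : selector 0 [set: 'F_p] m0.
Hypotheses (PPsym : forall j s, PP (- j - 1) (- s) = PP j s)
  (QQsym : forall k s, QQ (- k - 1) (- s) = QQ k s)
  (PQsym : forall j s, PQ (- j) (- s) = PQ j s).
Hypotheses (PP1 : forall j s, s != 0 -> one3 (PP j s) (PP (j - 1) s) (PQ j s))
  (PQ0 : forall s, PQ 0 s = false) (QQ0 : forall s, QQ 0 s = false)
  (QQ1 : forall k s, k != 0 -> s != 0 ->
     one3 (QQ k s) (QQ (k - 1) (- s)) (PQ (4 * k)^-1 (2 * k * s))).

Let F := 'F_p.

Let op : odd p.
Proof. by case: (even_prime pp) => // p2; move: p5; rewrite p2. Qed.

Let t2 := Fp_torsion2 pp op.

Let two_nz : (2 : F) != 0.
Proof. by rewrite Fp_natr_eq0 //; apply/negP => /(dvdn_leq (isT : (0 < 2)%N)); lia. Qed.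

Let two0 (x : F) : x *+ 2 = 0 -> x = 0.
Proof. by move/(torsion2P t2) => []. Qed.

Let three0 (x : F) : x *+ 3 = 0 -> x = 0.
Proof.
move=> /eqP; rewrite -mulr_natr mulf_eq0 Fp_natr_eq0 // => /orP[/eqP //|].
by move=> /(dvdn_leq (isT : (0 < 3)%N)); lia.
Qed.

(* For pairs from the odd part of the group; [a] and [b] are images in F_p. *)
Definition even_rule (a b : F) :=
  [|| a == b, a == - b | [&& nd 0 a b, nd 0 a (- b) & m0 a b]].

Let mC a b : m0 a b = m0 b a.
Proof. by case: sm => + _ _ _; apply; rewrite inE. Qed.

Let mN a b : m0 (- a) b = m0 a b.
Proof. by case: sm => _ + _ _; apply; rewrite inE. Qed.

Let nd_oppLR (a b : F) : nd 0 (- a) b = nd 0 a (- b).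
Proof. by rewrite -ndNN // opprK. Qed.

Lemma even_ruleC a b : even_rule a b = even_rule b a.
Proof.
rewrite /even_rule [nd 0 b a]ndC [m0 b a]mC [b == a]eq_sym [b == - a]eq_sym eqr_oppLR.
by rewrite [nd 0 b (- a)]ndC nd_oppLR.
Qed.

Lemma even_ruleN a b : even_rule (- a) b = even_rule a b.
Proof.
rewrite /even_rule mN eqr_opp [- a == b]eqr_oppLR ndNN // nd_oppLR.
by case: (a == b); case: (a == - b); case: (nd 0 a b); case: (nd 0 a (- b)).
Qed.

Let even_rule_nd a b : nd 0 a b -> even_rule a b = m0 a b.
Proof.
move=> n; rewrite /even_rule n.
have /and4P[/and4P[_ _ /eqP nab _] /eqP ne _ _] := n.
have -> : (a == b) = false by apply/eqP.
have -> : (a == - b) = false by apply/eqP => e; apply: nab; zby e.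
rewrite /=; case: (boolP (m0 a b)) => [mab|]; rewrite ?andbF ?andbT //.
rewrite -nd_oppLR; apply: nd_flip => //.
by case: sm => _ _ _ G; apply: G; rewrite ?inE.
Qed.

Lemma even_rule_double a : a != 0 -> even_rule a (a *+ 2) = false.
Proof.
move=> na; rewrite /even_rule.
have -> : (a == a *+ 2) = false.
  by apply: contraNF na => /eqP e; apply/eqP; zby e.
have -> : (a == - (a *+ 2)) = false.
  by apply: contraNF na => /eqP e; apply/eqP; apply: three0; zby e.
have -> : nd 0 a (- (a *+ 2)) = false by rewrite /nd subrr eqxx !andbF.
by rewrite andbF.
Qed.

Let even_rule0 a : a != 0 -> even_rule a 0 = false.
Proof. by move=> na; rewrite /even_rule /nd oppr0 (negPf na) eqxx /= ?andbF. Qed.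

Let even_ruleNr a b : even_rule a (- b) = even_rule a b.
Proof. by rewrite even_ruleC even_ruleN even_ruleC. Qed.

(** A nondegenerate triple follows the selector [m0]. A degenerate one is {0, x, -x} or {x, x, -2x},
    and exactly one of its pairs consists of equal or opposite elements; for the second shape this
    needs p different from 3. *)
Lemma even_rule_exact a b : (a != 0) || (b != 0) ->
  one3 (even_rule a b) (even_rule a (a + b)) (even_rule b (a + b)).
Proof.
move=> nab; have [n|] := boolP (nd 0 a b).
  have n1 := nd_rot t2 n; have n2 := nd_rot t2 n1.
  rewrite -(even_ruleNr a (a + b)) -(even_ruleNr b (a + b)).
  rewrite (even_rule_nd n) (even_rule_nd n1).
  have := n2; rewrite ndC (_ : - (b - (a + b)) = a); last by zmod.
  move=> /even_rule_nd ->.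
  case: sm => _ _ /(_ a b) + _; rewrite !inE => /(_ isT isT n).
  by rewrite [m0 a (- _)]mC mN [m0 b (- _)]mC mN [m0 (a + b) _]mC [m0 (a + b) b]mC.
have rr x : even_rule x x = true by rewrite /even_rule eqxx.
have rN x : even_rule x (- x) = true by rewrite /even_rule opprK eqxx orbT.
rewrite /nd !negb_and !negbK -!orbA.
have [a0 _|na] /= := eqVneq a 0.
  have nb : b != 0 by move: nab; rewrite a0 eqxx.
  by rewrite a0 add0r even_ruleC even_rule0 // rr.
have [b0 _|nb] /= := eqVneq b 0.
  by rewrite b0 addr0 [even_rule 0 a]even_ruleC !even_rule0 // rr.
have [e _|_] /= := eqVneq (a + b) 0.
  have -> : b = - a by zby e.
  by rewrite subrr rN even_ruleN !even_rule0.
have [<- _|_] /= := eqVneq a b.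
  by rewrite rr -mulr2n even_rule_double.
have [e _|_] /= := eqVneq (a *+ 2 + b) 0.
  have -> : b = - (a *+ 2) by zby e.
  have -> : a - a *+ 2 = - a by zmod.
  by rewrite rN even_ruleN !even_ruleNr [even_rule (a *+ 2) a]even_ruleC even_rule_double.
move/eqP => e.
have -> : a = - (b *+ 2) by zby e.
have -> : - (b *+ 2) + b = - b by zmod.
by rewrite rN !even_ruleN !even_ruleNr [even_rule (b *+ 2) b]even_ruleC even_rule_double.
Qed.

(* For elements y, z that are odd in the cyclic group of order 4, u and w are the
   images of the representatives of {y, -y}, {z, -z} of level 1; an even x enters
   as its image t, with [mixed_rule0] for level 0 and [mixed_rule2] for level 2.
   With s = u - w (resp. u + w) the vertex has index (u + w)/(2s) (resp.
   (u - w)/(2s)) on the outer (resp. inner) path. *)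
Definition odd_rule (u w : F) :=
  (u == w) || PQ ((u + w) / (2 * (u - w))) (u - w).

Definition mixed_rule0 (t u : F) := (t != 0) && PP (u / t - 2^-1) t.

Definition mixed_rule2 (t u : F) :=
  if t == 0 then (u <= p./2)%N else QQ (u / t - 2^-1) t.

Let half : (1 : F) = 2^-1 + 2^-1.
Proof. by rewrite -[RHS]mulr2n -[RHS]mulr_natr mulVf. Qed.

Let flip_center (u t : F) : u / - t - 2^-1 = - (u / t - 2^-1) - 1.
Proof. by rewrite invrN mulrN [X in _ = _ - X]half opprB opprD addrACA subrr add0r addrC. Qed.

Lemma mixed_rule0N t u : mixed_rule0 (- t) u = mixed_rule0 t u.
Proof. by rewrite /mixed_rule0 oppr_eq0 flip_center PPsym. Qed.

Lemma mixed_rule2N t u : mixed_rule2 (- t) u = mixed_rule2 t u.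
Proof. by rewrite /mixed_rule2 oppr_eq0 flip_center QQsym. Qed.

Lemma odd_ruleC u w : odd_rule u w = odd_rule w u.
Proof.
rewrite /odd_rule [w == u]eq_sym -(PQsym (_ / _)) opprB [w + u]addrC.
by rewrite -mulrN -invrN -mulrN opprB.
Qed.

Lemma odd_rule_opp u : u != 0 -> odd_rule u (- u) = false.
Proof.
move=> nu; rewrite /odd_rule subrr mul0r PQ0 orbF.
by apply: contraNF nu => /eqP e; apply/eqP/two0; zby e.
Qed.

(** With s = u - w and j = (u + w)/(2s), the indices u/s - 1/2 and w/s - 1/2 are j and j - 1, so
    this is the outer rule at j. *)
Lemma mixed_rule0_exact u w :
  one3 (mixed_rule0 (u - w) u) (mixed_rule0 (u - w) w) (odd_rule u w).
Proof.
rewrite /mixed_rule0 /odd_rule subr_eq0; have [//|nuw] := eqVneq u w.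
set s := u - w; have ns : s != 0 by rewrite subr_eq0.
have := PP1 ((u + w) / (2 * s)) ns; rewrite /=.
have e2 : u / s - 2^-1 = (u + w) / (2 * s).
  by rewrite /s; field; rewrite ?two_nz -/s ?ns.
have e3 : w / s - 2^-1 = (u + w) / (2 * s) - 1.
  by rewrite /s; field; rewrite ?two_nz -/s ?ns.
by rewrite e2 e3.
Qed.

(** With s = u + w and k = (u - w)/(2s), the two indices are k and -k, and the symmetry of [QQ]
    moves the latter to k - 1 with parameter -s: the inner rule at k. For s = 0 no index exists, and
    a half-system decides between u and w = -u. *)
Lemma mixed_rule2_exact u w : (u != 0) || (w != 0) ->
  one3 (mixed_rule2 (u + w) u) (mixed_rule2 (u + w) w) (odd_rule u w).
Proof.
move=> nuw; rewrite /mixed_rule2; have [e|ns] := eqVneq (u + w) 0.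
  have ew : w = - u by zby e.
  have nu : u != 0 by move: nuw; rewrite ew oppr_eq0 orbb.
  rewrite ew odd_rule_opp // Fp_valN //.
  have lt := Fp_val_lt u pp.
  have -> : (p - u <= p./2)%N = ~~ (u <= p./2)%N.
    by have := odd_double_half p; rewrite op; lia.
  by case: (u <= _)%N.
set s := u + w in ns *.
have e1 : u / s - 2^-1 = (u - w) / (2 * s).
  by rewrite /s; field; rewrite ?two_nz -/s ?ns.
have e2 : w / s - 2^-1 = - ((u - w) / (2 * s)).
  by rewrite /s; field; rewrite ?two_nz -/s ?ns.
rewrite e1 e2 /odd_rule -[QQ (- _) s]QQsym opprK.
have [<-|nd] := eqVneq u w.
  have := QQsym 0 s; rewrite oppr0 => e0.
  by rewrite subrr mul0r e0 QQ0.
have nuw' : u - w != 0 by rewrite subr_eq0.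
set k := (u - w) / (2 * s).
have nk : k != 0 by rewrite mulf_neq0 // invr_eq0 mulf_neq0.
have := QQ1 nk ns; rewrite /=.
have four : (4 : F) = 2 * 2 by rewrite -natrM.
have gen (c x y : F) : c != 0 -> y != 0 -> c * c * (x / (c * y)) = c * x / y.
  by move=> nc ny; rewrite mulrA -[c * c * x]mulrA -mulf_div divff // mul1r.
have -> : (4 * k)^-1 = (u + w) / (2 * (u - w)).
  by rewrite four /k gen // invf_div.
have -> // : 2 * k * s = u - w.
by rewrite /k; field; rewrite ?two_nz ?ns.
Qed.

Lemma mixed_rule2_double u : u != 0 -> mixed_rule2 (u *+ 2) u = false.
Proof.
move=> nu; have n2 : u *+ 2 != 0 by apply: contraNneq nu => /two0 ->.
rewrite /mixed_rule2 (negPf n2) -[u *+ 2]mulr_natr.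
have -> : u / (u * 2) - 2^-1 = 0 by field; rewrite ?two_nz ?nu.
exact: QQ0.
Qed.

End FpRules.

Lemma zmod_groupN (A : finZmodType) (H : {group A}) (a : A) : (- a \in H) = (a \in H).
Proof. by rewrite -FinRing.zmodVgE groupV. Qed.

Lemma zmod_groupD (A : finZmodType) (H : {group A}) (a b : A) :
  a \in H -> b \in H -> a + b \in H.
Proof. by move=> aH bH; rewrite -FinRing.zmodMgE groupM. Qed.

(* [lev] is the level modulo 4; when the Sylow 2-subgroup has order 2 it only
   takes the values 0 and 2. *)
Section Step.

Variables (A : finZmodType) (h : A) (lev : A -> nat) (H : {group A}) (p : nat).
Variables (phi : A -> 'F_p) (m0 PP QQ PQ : 'F_p -> 'F_p -> bool) (mK : A -> A -> bool).
Hypotheses (levD : forall a b, lev (a + b) = ((lev a + lev b) %% 4)%N)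
  (lev_h : lev h = 2%N) (hH : h \in H).
Hypotheses (phiD : {in H &, {morph phi : a b / a + b}}) (phi_h : phi h = 0).
Hypotheses (pp : prime p) (p5 : (5 <= p)%N).
Hypothesis sm : selector 0 [set: 'F_p] m0.
Hypotheses (PPsym : forall j s, PP (- j - 1) (- s) = PP j s)
  (QQsym : forall k s, QQ (- k - 1) (- s) = QQ k s)
  (PQsym : forall j s, PQ (- j) (- s) = PQ j s).
Hypotheses (PP1 : forall j s, s != 0 -> one3 (PP j s) (PP (j - 1) s) (PQ j s))
  (PQ0 : forall s, PQ 0 s = false) (QQ0 : forall s, QQ 0 s = false)
  (QQ1 : forall k s, k != 0 -> s != 0 ->
     one3 (QQ k s) (QQ (k - 1) (- s)) (PQ (4 * k)^-1 (2 * k * s))).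
Hypothesis sK : selector h [set x in H | phi x == 0] mK.

Let lev_lt a : (lev a < 4)%N.
Proof. by rewrite -[a]addr0 levD ltn_mod. Qed.

Let lev0 : lev 0 = 0%N.
Proof. by have := levD 0 0; rewrite addr0; have := lev_lt 0; move: (lev 0) => [|[|[|[|]]]]. Qed.

Let levN a : lev (- a) = ((4 - lev a) %% 4)%N.
Proof.
have := levD a (- a); rewrite subrr lev0.
have := lev_lt a; have := lev_lt (- a).
by move: (lev a) (lev (- a)) => [|[|[|[|]]]] // [|[|[|[|]]]].
Qed.

Let phiN a : a \in H -> phi (- a) = - phi a.
Proof.
move=> aH; have H0 : 0 \in H by rewrite -(subrr a) zmod_groupD ?zmod_groupN.
have e0 : phi 0 = 0 by have := phiD H0 H0; rewrite addr0 => e; zby e.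
by have := phiD aH (_ : - a \in H); rewrite zmod_groupN subrr e0 => /(_ aH) e; zby e.
Qed.

Let sg y := if lev y == 1%N then phi y else - phi y.

Let mixed x y :=
  if lev x == 0%N then mixed_rule0 PP (phi x) (sg y) else mixed_rule2 QQ (phi x) (sg y).

Let off_rule a b :=
  if odd (lev a) then
    if odd (lev b) then odd_rule PQ (sg a) (sg b) else mixed b a
  else if odd (lev b) then mixed a b
  else if (lev a == 0%N) && (lev b == 0%N) then even_rule m0 (phi a) (phi b)
  else (lev a == 2%N) && (lev b == 2%N).

Definition step_rule a b :=
  if (phi a == 0) && (phi b == 0) then mK a b else off_rule a b.

Let lev_cases a : [\/ lev a = 0%N, lev a = 1%N | lev a = 2%N] \/ lev a = 3%N.
Proof.
have := lev_lt a; move: (lev a) => [|[|[|[|]]]] // _;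
by [left; constructor 1 | left; constructor 2 | left; constructor 3 | right].
Qed.

Let sgN y : y \in H -> odd (lev y) -> sg (- y) = sg y.
Proof.
move=> yH; rewrite /sg levN phiN //; have := lev_lt y.
by move: (lev y) => [|[|[|[|]]]] //= _ _; rewrite opprK.
Qed.

Let mixedNl x y : x \in H -> ~~ odd (lev x) -> mixed (- x) y = mixed x y.
Proof.
move=> xH; rewrite /mixed levN phiN //; have := lev_lt x.
by move: (lev x) => [|[|[|[|]]]] //= _ _; rewrite ?mixed_rule0N ?mixed_rule2N.
Qed.

Let mixedNr x y : y \in H -> odd (lev y) -> mixed x (- y) = mixed x y.
Proof. by move=> yH oy; rewrite /mixed sgN. Qed.

Let off_ruleC a b : off_rule a b = off_rule b a.
Proof.
rewrite /off_rule; case: (odd (lev a)); case: (odd (lev b)) => //.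
  by rewrite odd_ruleC.
by rewrite even_ruleC // andbC [(lev a == 2%N) && _]andbC.
Qed.

Let oddN a : odd (lev (- a)) = odd (lev a).
Proof. by rewrite levN; have := lev_lt a; move: (lev a) => [|[|[|[|]]]]. Qed.

Let off_ruleN a b : a \in H -> b \in H -> off_rule (- a) b = off_rule a b.
Proof.
move=> aH bH; rewrite /off_rule oddN.
case: ifP => oa; first by rewrite sgN // mixedNr.
rewrite mixedNl ?oa // phiN // even_ruleN //.
by rewrite levN; have := lev_lt a; move: (lev a) => [|[|[|[|]]]].
Qed.

(** If x has level 0, then y and c have equal level and [phi x] is, up to sign, the difference of
    their representatives. If x has level 2, levels 1 and 3 are exchanged and it is, up to sign,
    their sum. *)
Let mixed_exact x y c : x \in H -> y \in H -> c = x + y ->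
  ~~ odd (lev x) -> odd (lev y) -> (phi x != 0) || (phi y != 0) ->
  one3 (mixed x y) (mixed x c) (odd_rule PQ (sg y) (sg c)).
Proof.
move=> xH yH -> ex oy nxy; rewrite /mixed.
have lc := levD x y; have fc := phiD xH yH.
move: ex oy; case: (lev_cases x) => [[]|] lx; rewrite lx //= => _;
case: (lev_cases y) => [[]|] ly; rewrite ly //= => _;
rewrite lx ly in lc; rewrite /sg lc ly fc /=.
- have e : - phi x = phi y - (phi x + phi y) by zmod.
  rewrite -[mixed_rule0 PP (phi x) (phi y)]mixed_rule0N //.
  rewrite -[mixed_rule0 PP (phi x) (phi x + _)]mixed_rule0N // e.
  exact: mixed_rule0_exact.
- have -> : mixed_rule0 PP (phi x) = mixed_rule0 PP (- phi y - - (phi x + phi y)).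
    by congr (mixed_rule0 PP _); zmod.
  exact: mixed_rule0_exact.
- have e : - phi x = phi y - (phi x + phi y) by zmod.
  rewrite -[mixed_rule2 QQ (phi x) (phi y)]mixed_rule2N //.
  rewrite -[mixed_rule2 QQ (phi x) (- _)]mixed_rule2N // e; apply: mixed_rule2_exact => //.
  rewrite oppr_eq0; move: nxy; case: (phi y =P 0) => [->|] //=.
  by rewrite addr0 orbF.
- have e : phi x = - phi y + (phi x + phi y) by zmod.
  have gen (t u w : 'F_p) : t = u + w -> (u != 0) || (w != 0) ->
      one3 (mixed_rule2 QQ t u) (mixed_rule2 QQ t w) (odd_rule PQ u w).
    by move=> -> nuw; apply: mixed_rule2_exact.
  apply: gen e _.
  rewrite oppr_eq0; move: nxy; case: (phi y =P 0) => [->|] //=.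
  by rewrite addr0 orbF.
Qed.

(** Either two of the three levels are odd, which is [mixed_exact], or all are even. In the latter
    case all are 0, which is [even_rule_exact], or exactly two are 2 and these form the chosen
    pair. *)
Let off_exact a b : a \in H -> b \in H -> ~~ ((phi a == 0) && (phi b == 0)) ->
  one3 (off_rule a b) (off_rule a (a + b)) (off_rule b (a + b)).
Proof.
move=> aH bH nab; have lc := levD a b; have fc := phiD aH bH.
have cH := zmod_groupD aH bH; rewrite negb_and in nab.
have oc : odd (lev (a + b)) = odd (lev a) (+) odd (lev b).
  rewrite lc; have := lev_lt a; have := lev_lt b.
  by move: (lev a) (lev b) => [|[|[|[|]]]] // [|[|[|[|]]]].
have [oa|/negbTE oa] := boolP (odd (lev a)); have [ob|/negbTE ob] := boolP (odd (lev b));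
  rewrite oa ob /= in oc.
- have e : b = (a + b) + - a by zmod.
  have aNH : - a \in H by rewrite zmod_groupN.
  rewrite /off_rule oa ob oc one3_swap12 one3_swap23.
  rewrite -(mixedNr (a + b) aH oa) -[in odd_rule PQ _ _](sgN aH oa).
  apply: mixed_exact e _ _ _ => //; rewrite ?oc ?oddN // phiN // oppr_eq0 fc.
  by move: nab; have [->|] := eqVneq (phi a) 0; rewrite ?add0r ?eqxx ?orbF ?orbT.
- rewrite /off_rule oa ob oc one3_swap23.
  by apply: mixed_exact; rewrite ?ob // 1?addrC // orbC.
- rewrite /off_rule oa ob oc.
  by apply: mixed_exact; rewrite ?oa.
rewrite /off_rule oa ob oc.
case: (lev_cases a) oa => [[]|] la; rewrite la // => _;
case: (lev_cases b) ob => [[]|] lb; rewrite lb // => _; rewrite la lb in lc; rewrite lc //=.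
by rewrite fc; apply: even_rule_exact.
Qed.

(** Adding [h] keeps [phi] and shifts the level by 2, so a pair differing by [h] has opposite
    representatives or the levels 0 and 2. A pair [a], [a *+ 2] is excluded by the doubling lemmas
    or by its levels. *)
Let off_good a b : a \in H -> b \in H -> ~~ ((phi a == 0) && (phi b == 0)) ->
  off_rule a b -> (a - b != h) && (a *+ 2 != b).
Proof.
move=> aH bH nab oab; apply/andP; split; apply/eqP => e; move: oab.
  have ea : a = b + h by zby e.
  have la := levD b h; have fa := phiD bH hH.
  move: nab; rewrite ea /off_rule fa phi_h addr0 andbb la lev_h => nb.
  case: (lev_cases b) => [[]|] lb; rewrite lb //=.
    rewrite /sg -ea.
    have -> : lev a = 3%N by rewrite ea la lb lev_h.
    rewrite lb ea fa phi_h addr0 /= odd_ruleC // odd_rule_opp //.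
  rewrite /sg -ea.
  have -> : lev a = 1%N by rewrite ea la lb lev_h.
  by rewrite lb ea fa phi_h addr0 /= odd_rule_opp.
have fb : phi b = phi a *+ 2 by rewrite -e !mulr2n phiD.
have lb : lev b = ((lev a + lev a) %% 4)%N by rewrite -e mulr2n levD.
have na : phi a != 0.
  by move: nab; rewrite fb; case: (phi a =P 0) => // ->; rewrite mul0rn eqxx.
rewrite /off_rule; case: (lev_cases a) => [[]|] la; rewrite la in lb; rewrite la lb //=.
- by rewrite fb even_rule_double.
- by rewrite /mixed lb /sg la fb /= mixed_rule2_double.
rewrite /mixed lb /sg la fb /= -mixed_rule2N // -mulNrn mixed_rule2_double //.
by rewrite oppr_eq0.
Qed.

Lemma step_selector : selector h H step_rule.
Proof.
have inK a : a \in H -> phi a == 0 -> a \in [set x in H | phi x == 0].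
  by move=> aH a0; rewrite inE aH.
case: sK => KC KN K1 KG; split.
- move=> a b aH bH; rewrite /step_rule andbC; case: ifP => [/andP[b0 a0]|_].
    by rewrite KC ?inK.
  exact: off_ruleC.
- move=> a b aH bH; rewrite /step_rule phiN // oppr_eq0; case: ifP => [/andP[a0 b0]|_].
    by rewrite KN ?inK.
  exact: off_ruleN.
- move=> a b aH bH n; rewrite /step_rule phiD //.
  have [/andP[/eqP a0 /eqP b0]|nab] := boolP ((phi a == 0) && (phi b == 0)).
    by rewrite a0 b0 addr0 eqxx /=; apply: K1 => //; apply: inK; rewrite ?a0 ?b0.
  (* If two of the three images vanish, so does the third; hence a triple not inside the kernel uses
     [off_rule] for all three pairs. *)
  have -> : (phi a == 0) && (phi a + phi b == 0) = false.
    by apply: contraNF nab => /andP[/eqP -> /eqP]; rewrite add0r => ->; rewrite eqxx.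
  have -> : (phi b == 0) && (phi a + phi b == 0) = false.
    by apply: contraNF nab => /andP[/eqP -> /eqP]; rewrite addr0 => ->; rewrite eqxx.
  exact: off_exact.
move=> a b aH bH n; rewrite /step_rule.
have [/andP[a0 b0]|nab] := boolP ((phi a == 0) && (phi b == 0)).
  by apply: KG => //; apply: inK.
move=> oab; have /andP[-> ->] := off_good aH bH nab oab.
rewrite off_ruleC in oab; rewrite andbC in nab.
by have /andP[_ ->] := off_good bH aH nab oab.
Qed.
End Step.

(** * Cyclic Sylow 2-subgroups *)

Lemma Zp_set_card n : (1 < n)%N -> #|[set: 'Z_n]| = n.
Proof. by move=> n1; rewrite cardsT card_ord Zp_cast. Qed.

Lemma Zp_set_cyclic n : cyclic [set: 'Z_n].
Proof. by rewrite Zp_cycle cycle_cyclic. Qed.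

Lemma Zp_cyclic_Sylow2 n : cyclic_Sylow2 'Z_n.
Proof. by move=> P _; apply: cyclicS (subsetT P) (Zp_set_cyclic n). Qed.

Lemma cyclic_hom (gT : finGroupType) (G : {group gT}) n :
  cyclic G -> #|G| = n -> (1 < n)%N ->
  exists f : gT -> 'Z_n, {in G &, forall x y, f (x * y)%g = f x + f y} /\
    {in G, forall x, (f x == 0) = (x == 1%g)}.
Proof.
move=> cG cardG n1.
have : G \isog [set: 'Z_n].
  by rewrite isog_cyclic_card // Zp_set_cyclic Zp_set_card // cardG eqxx.
case/isogP => f inj_f _; exists f; split=> [x y xG yG|x xG].
  by rewrite morphM.
by rewrite -(morph_injm_eq1 inj_f xG).
Qed.

Lemma zmod_sub_normal (A : finZmodType) (H K : {group A}) : K \subset H -> (K <| H)%g.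
Proof. by move=> KH; rewrite -sub_abelian_normal ?FinRing.zmod_abelian. Qed.

Lemma index_prime_hom (A : finZmodType) (H K : {group A}) p : K \subset H ->
  prime p -> #|H / K|%g = p ->
  exists phi : A -> 'F_p, {in H &, {morph phi : a b / a + b}} /\
    {in H, forall x, (phi x == 0) = (x \in K)}.
Proof.
move=> KH pp cardHK; have nKH := normal_norm (zmod_sub_normal KH).
have cHK : cyclic (H / K)%g by rewrite prime_cyclic // cardHK.
(* ['F_p] unfolds to ['Z_(pdiv p)], hence the modulus [pdiv p]. *)
have [|f [fM f1]] := cyclic_hom (n := pdiv p) cHK _ (prime_gt1 (pdiv_prime (prime_gt1 pp))).
  by rewrite cardHK pdiv_id.
exists (fun x => f (coset K x)); split=> [x y xH yH|x xH].
  by rewrite -FinRing.zmodMgE morphM ?(subsetP nKH) // fM // mem_quotient.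
rewrite f1 ?mem_quotient //; apply/eqP/idP => [e|]; last exact: coset_id.
by apply: coset_idr; rewrite ?(subsetP nKH).
Qed.

Lemma cycle_embedding (A : finZmodType) (z : A) n : (1 < n)%N -> #[z]%g = n ->
  exists f : 'Z_n -> A, [/\ {morph f : x y / x + y}, injective f
    & forall k, f k%:R = z *+ k].
Proof.
move=> n1 oz; have zn k : z *+ (k %% n) = z *+ k.
  by rewrite -!FinRing.zmodXgE expg_mod // -oz expg_order.
have ltn (x : 'Z_n) : (x < n)%N by rewrite -[X in (_ < X)%N](Zp_cast n1) ltn_ord.
have vD (x y : 'Z_n) : (x + y : 'Z_n) = ((x + y)%N %% n)%N :> nat.
  by rewrite -[X in (_ %% X)%N](Zp_cast n1).
exists (fun k : 'Z_n => z *+ k); split=> [x y|x y e|k].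
- by rewrite vD zn mulrnDr.
- have := eq_expg_mod_order z x y; rewrite !FinRing.zmodXgE e eqxx oz.
  by rewrite !modn_small // => /esym/eqP/val_inj.
by rewrite val_Zp_nat // zn.
Qed.

Lemma zmod_order_dvd (A : finZmodType) (x : A) n : (#[x]%g %| n)%N = (x *+ n == 0).
Proof. by rewrite order_dvdn FinRing.zmodXgE. Qed.

Lemma zmod_order_card (A : finZmodType) (x : A) : (#[x]%g %| #|A|)%N.
Proof. by rewrite -cardsT order_dvdG ?inE. Qed.

Lemma zmod_Cauchy (A : finZmodType) p : prime p -> (p %| #|A|)%N ->
  exists x : A, #[x]%g = p.
Proof. by move=> pp; rewrite -cardsT => /(Cauchy pp)[x _ ox]; exists x. Qed.

Lemma torsion_free_prime (A : finZmodType) p (x : A) : prime p ->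
  ~~ (p %| #|A|)%N -> x *+ p = 0 -> x = 0.
Proof.
move=> pp npA /eqP; rewrite -zmod_order_dvd => /(primeP pp).2.
case/orP => /eqP ox; last by case/negP: npA; rewrite -ox zmod_order_card.
by apply/eqP; rewrite -[x]mulr1n -zmod_order_dvd ox.
Qed.

Lemma torsion3_free_card (A : finZmodType) : ~~ (3 %| #|A|)%N -> torsion3_free A.
Proof. by move=> n3 x; apply: torsion_free_prime. Qed.

Lemma card_torsion3_free (A : finZmodType) : torsion3_free A -> ~~ (3 %| #|A|)%N.
Proof.
move=> t3; apply/negP => /(zmod_Cauchy (isT : prime 3))[x ox].
have x0 : x = 0 by apply/t3/eqP; rewrite -zmod_order_dvd ox.
by move: ox; rewrite x0 -FinRing.zmod1gE order1.
Qed.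

Lemma Sylow_mem (A : finZmodType) p (P : {group A}) (x : A) :
  p.-Sylow([set: A])%g P -> (x \in P) = (x *+ #|P| == 0).
Proof.
move=> sylP; have nP : (P <| [set: A])%g := zmod_sub_normal (subsetT P).
rewrite -zmod_order_dvd; apply/idP/idP => [xP|dx]; first exact: order_dvdG.
by rewrite (mem_normal_Hall sylP) ?inE //; apply: pnat_dvd dx (pHall_pgroup sylP).
Qed.

(** All involutions lie in the cyclic Sylow 2-subgroup, which has only one subgroup of order 2. *)
Lemma torsion2_ex (A : finZmodType) : cyclic_Sylow2 A -> (2 %| #|A|)%N ->
  exists h : A, h != 0 /\ torsion2 h.
Proof.
move=> cyc dA; have [h oh] := zmod_Cauchy (isT : prime 2) dA.
have nh : h != 0 by apply: contraPneq oh => ->; rewrite -FinRing.zmod1gE order1.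
have [P sylP] := Sylow_exists 2 [set: A].
have cP := cyc P sylP.
have P2 : (2 %| #|P|)%N.
  by rewrite (card_Hall sylP) cardsT p_part dvdn_exp // logn_gt0 mem_primes dA -cardsT cardG_gt0.
have inP (x : A) : #[x]%g = 2%N -> x \in P.
  by move=> ox; rewrite (Sylow_mem _ sylP) -zmod_order_dvd ox.
exists h; split=> // x; apply/idP/idP => [x2|/orP[]/eqP->]; first last.
- by rewrite -zmod_order_dvd oh.
- by rewrite mul0rn.
have [//|nx] := eqVneq x 0.
have ox : #[x]%g = 2%N.
  apply/eqP; move: x2; rewrite -zmod_order_dvd => /(primeP (isT : prime 2)).2 /orP[|//].
  by rewrite order_eq1 FinRing.zmod1gE (negPf nx).
have /eqP e : (<[x]> == <[h]> :> {set A})%g.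
  by rewrite (eq_subG_cyclic cP) ?cycle_subG ?inP // -!orderE ox oh.
have : x \in <[h]>%g by rewrite -e cycle_id.
by rewrite cycle2g // !inE FinRing.zmod1gE (negPf nx).
Qed.

(** * Necessary conditions on the order *)

Lemma cycle_comap (A : finZmodType) (h : A) (m : A -> A -> bool) (z : A) n :
  torsion2 h -> selector h [set: A] m -> (1 < n)%N -> #[z]%g = n ->
  forall k : 'Z_n, torsion2 k -> exists m', selector k [set: 'Z_n] m'.
Proof.
move=> t2 sm n1 oz k tk; have [f [fD finj _]] := cycle_embedding n1 oz.
by exists (fun a b => m (f a) (f b)); apply: selector_comap tk sm.
Qed.

(** In odd order [h = 0] satisfies [torsion2], and the forced block {0, h, r, -r} would have a
    repeated point. *)
Lemma system_card_even (A : finZmodType) :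
  (1 < #|A|)%N -> has_reversible_SQS A -> (2 %| #|A|)%N.
Proof.
move=> cA [Bs rB]; apply/negPn/negP => odd_A.
have t2 : torsion2 (0 : A).
  move=> x; rewrite orbb; apply/eqP/eqP => [|->]; last exact: mul0rn.
  exact: torsion_free_prime.
have [r nr] : exists r : A, r != 0.
  apply/existsP; move: cA; apply: contraLR; rewrite negb_exists => /forallP all0.
  rewrite -leqNgt -cardsT -(cards1 (0 : A)) subset_leq_card //.
  by apply/subsetP => x _; rewrite inE; have := all0 x; rewrite negbK.
have r2 : r *+ 2 != 0 by rewrite t2 orbb.
by have := block_uniq rB (block_forced t2 rB r2); rewrite /= !inE eqxx.
Qed.

(* Each of the three blocks available for {r, 2r, -3r} meets a degenerate triple. *)
Lemma selector_no_order8 (A : finZmodType) (h : A) m (r : A) :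
  torsion2 h -> selector h [set: A] m -> #[r]%g <> 8%N.
Proof.
move=> t2 [mC mN m1 mG] o8; have h2 := torsion2_mul2 t2.
have rn k : ~~ (8 %| k)%N -> r *+ k <> 0.
  by move=> nk; apply/eqP; rewrite -zmod_order_dvd o8.
have r8 : r *+ 8 = 0 by apply/eqP; rewrite -zmod_order_dvd o8.
have eh : h = r *+ 4.
  have: (r *+ 4) *+ 2 = 0 by zby r8.
  by case/(torsion2P t2) => // e; case: (rn 4%N).
have r1 : r <> 0 := rn 1%N isT; have r2 := rn 2%N isT; have r3 := rn 3%N isT.
have r4 := rn 4%N isT; have r5 := rn 5%N isT; have r6 := rn 6%N isT; have r7 := rn 7%N isT.
have nd1 : nd h r (r *+ 2).
  rewrite /nd eh; do !(apply/andP; split); apply/eqP => e;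
  by [apply: r1; zany2 e r8 | apply: r2; zany2 e r8 | apply: r3; zany2 e r8 | apply: r4; zany2 e r8 | apply: r5; zany2 e r8].
have nd2 : nd h r (- (r *+ 3)).
  by have := nd_rot t2 (nd_rot t2 nd1); rewrite ndC; congr (is_true (nd _ _ _)); zmod.
have nd3 : nd h (r *+ 2) (- (r *+ 3)).
  by have := nd_rot t2 nd1; congr (is_true (nd _ _ _)); zmod.
have := m1 r (r *+ 2); rewrite !inE => /(_ isT isT nd1).
have e3 : r + r *+ 2 = r *+ 3 by zmod.
have -> : m r (r *+ 2) = false.
  by apply/negP => /(mG _ _ (in_setT _) (in_setT _) nd1); rewrite eqxx andbF.
have mNr a b : m a (- b) = m a b by rewrite mC ?inE // mN ?inE // mC ?inE.
rewrite e3 -(mNr r) -(mNr (r *+ 2)).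
have -> : m r (- (r *+ 3)) = false.
  apply/negP => /(mG _ _ (in_setT _) (in_setT _) nd2) /and3P[/eqP ne _ _]; apply: ne.
  by rewrite eh; zmod.
have -> // : m (r *+ 2) (- (r *+ 3)) = false.
apply/negP => /(mG _ _ (in_setT _) (in_setT _) nd3) /and3P[_ _ /eqP ne]; apply: ne.
by zby r8.
Qed.

Lemma cyclic_order8 (A : finZmodType) : cyclic_Sylow2 A -> (8 %| #|A|)%N ->
  exists r : A, #[r]%g = 8%N.
Proof.
move=> cyc dA; have [P sylP] := Sylow_exists 2 [set: A].
have /cyclicP[g Eg] := cyc P sylP.
have d8 : (8 %| #[g]%g)%N.
  rewrite orderE -Eg (card_Hall sylP) cardsT p_part (@dvdn_exp2l 2 3) //.
  by rewrite -(@pfactor_dvdn 2 3) // -cardsT cardG_gt0.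
exists (g ^+ (#[g] %/ 8))%g; have g0 := order_gt0 g.
by rewrite orderXdiv ?dvdn_div // divnA // mulKn.
Qed.

Lemma system_necessary (A : finZmodType) : (1 < #|A|)%N -> cyclic_Sylow2 A ->
  has_reversible_SQS A ->
  [/\ #|A| = 0 %[mod 2], #|A| <> 0 %[mod 3], #|A| <> 0 %[mod 8]
    & forall p : nat, prime p -> odd p -> (p %| #|A|)%N -> has_S_cyclic_SQS (2 * p)%N].
Proof.
move=> cA cyc hA; have dA := system_card_even cA hA.
have [h [nh t2]] := torsion2_ex cyc dA; case: hA => Bs rB.
have sm := selector_of_system t2 rB nh.
have t3 := system_torsion3_free rB.
have d3 := card_torsion3_free t3.
split.
- by rewrite mod0n; apply/eqP.
- by rewrite mod0n => /eqP e; case/negP: d3.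
- rewrite mod0n => /eqP e; have [r] := cyclic_order8 cyc e.
  exact: selector_no_order8 t2 sm.
move=> p pp op pA; have [x ox] := zmod_Cauchy pp pA.
have oh : #[h]%g = 2%N.
  apply/eqP; have := torsion2_mul2 t2 => /eqP; rewrite -zmod_order_dvd.
  move=> /(primeP (isT : prime 2)).2 /orP[|//].
  by rewrite order_eq1 FinRing.zmod1gE (negPf nh).
have p1 := prime_gt1 pp.
have n1 : (1 < 2 * p)%N by lia.
(* The cyclic subgroup generated by x + h is a copy of Z_2p containing [h]; p being odd, [p%:R] is
   sent to [h]. *)
have oz : #[x + h]%g = (2 * p)%N.
  rewrite -FinRing.zmodMgE orderM ?ox ?oh ?(mulnC p) //.
    by rewrite /commute !FinRing.zmodMgE addrC.
  by rewrite coprimen2.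
have [f [fD finj fk]] := cycle_embedding n1 oz.
have f0 : f 0 = 0 by have := fD 0 0; rewrite addr0 => e; zby e.
have fp : f p%:R = h.
  rewrite fk mulrnDl -[X in _ + h *+ X](odd_double_half p) op mulrnDr.
  have -> : x *+ p = 0 by apply/eqP; rewrite -zmod_order_dvd ox.
  by rewrite -mul2n mulrnA (torsion2_mul2 t2) mul0rn addr0 add0r.
have fMn a k : f (a *+ k) = f a *+ k.
  by elim: k => [|k IH]; rewrite ?mulr0n // !mulrS fD IH.
have f_eq a b : (f a == f b) = (a == b) := inj_eq finj a b.
have tB : torsion2 (p%:R : 'Z_(2 * p)).
  by move=> a; rewrite -(f_eq (a *+ 2)) -(f_eq a 0) -(f_eq a p%:R) fMn f0 fp t2.
have t3B : torsion3_free 'Z_(2 * p).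
  by move=> a e; apply: finj; rewrite f0; apply: t3; rewrite -fMn e f0.
apply: system_of_selector tB _ t3B (selector_comap fD finj t2 tB sm).
by rewrite -(inj_eq finj) fp f0.
Qed.

(** * Building a selector from condition (iv) *)

Lemma Fp_selector p : prime p -> odd p -> has_S_cyclic_SQS (2 * p)%N ->
  exists m, selector 0 [set: 'F_p] m.
Proof.
move=> pp op hS; have n1 : (1 < 2 * p)%N by have := prime_gt1 pp; lia.
have cardZ : #|'Z_(2 * p)| = (2 * p)%N by rewrite -cardsT Zp_set_card.
have [|h [nh t2]] := torsion2_ex (@Zp_cyclic_Sylow2 (2 * p)%N).
  by rewrite cardZ dvdn_mulr.
have [Bs rB] := hS; have sm := selector_of_system t2 rB nh.
(* The subgroup of order p has no involution, so the selector restricts to one with [h = 0]. *)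
have [z oz] : exists z : 'Z_(2 * p), #[z]%g = p.
  by apply: zmod_Cauchy; rewrite ?cardZ ?dvdn_mull.
have pd1 : (1 < pdiv p)%N by rewrite pdiv_id ?prime_gt1.
have oz' : #[z]%g = pdiv p by rewrite pdiv_id.
have [m' sm'] := cycle_comap t2 sm pd1 oz' (Fp_torsion2 pp op).
by exists m'.
Qed.

(** Multiplication by the odd part [m] of the order maps A into P and fixes [h]; an embedding of P
    into Z_4 then yields [lev]. P has order 2 or 4, so elements a, b of P outside {0, h} have 2a =
    2b = h and a + b is 2-torsion. *)
Lemma Sylow2_level (A : finZmodType) (h : A) : cyclic_Sylow2 A -> h != 0 ->
  torsion2 h -> (2 %| #|A|)%N -> ~~ (8 %| #|A|)%N ->
  exists (P : {group A}) (lev : A -> nat),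
    [/\ 2.-Sylow([set: A])%g P, h \in P, {in P &, forall a b, ~~ nd h a b},
        forall a b, lev (a + b) = ((lev a + lev b) %% 4)%N & lev h = 2%N].
Proof.
move=> cyc nh t2 d2 d8; have h2 := torsion2_mul2 t2.
have [P sylP] := Sylow_exists 2 [set: A]; have cP := cyc P sylP.
have A0 : (0 < #|A|)%N by rewrite -cardsT cardG_gt0.
have cardP : #|P| = 2%N \/ #|P| = 4%N.
  have := card_Hall sylP; rewrite cardsT p_part.
  move: d2 d8; rewrite (@pfactor_dvdn 2 1) // (@pfactor_dvdn 2 3) //.
  by move: (logn 2 #|A|) => [|[|[|]]] //; auto.
have memP (x : A) : (x \in P) = (x *+ #|P| == 0) := Sylow_mem x sylP.
have P4 (x : A) : x \in P -> x *+ 4 = 0.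
  rewrite memP => /eqP e; case: cardP e => -> e //.
  by zby2 e e.
have hP : h \in P.
  by rewrite memP; case: cardP => ->; rewrite ?h2 // -[4%N]/(2 * 2)%N mulrnA h2 mul0rn.
have [m mA om] : exists2 m, #|A| = (m * #|P|)%N & odd m.
  exists (#|A| %/ #|P|)%N; first by rewrite divnK // -cardsT cardSg ?subsetT.
  rewrite -cardsT divgS ?subsetT // -[odd _]negbK -dvdn2 -p'natE //.
  by case/and3P: sylP.
have powP (a : A) : a *+ m \in P.
  by rewrite memP -mulrnA -mA -zmod_order_dvd zmod_order_card.
have hm : h *+ m = h.
  rewrite -(odd_double_half m) om mulrnDr -mul2n mulrnA h2 mul0rn addr0.
  by rewrite mulr1n.
have ndP : {in P &, forall a b, ~~ nd h a b}.
  move=> a b aP bP; apply/negP; rewrite /nd => /and4P[/and5P[na nb nc nah /andP[nbh nch]] _ _ _].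
  have dbl (x : A) : x \in P -> x != 0 -> x != h -> x *+ 2 = h.
    move=> xP nx nxh; have: (x *+ 2) *+ 2 = 0 by rewrite -mulrnA P4.
    by case/(torsion2P t2) => // /eqP; rewrite t2 (negPf nx) (negPf nxh).
  have ea := dbl _ aP na nah; have eb := dbl _ bP nb nbh.
  have: (a + b) *+ 2 == 0 by rewrite mulrnDl ea eb -mulr2n h2.
  by rewrite t2 (negPf nc) (negPf nch).
have fh0 (gT : zmodType) (f : A -> gT) : {in P &, forall x y, f (x * y)%g = f x + f y} ->
    f h *+ 2 = 0.
  move=> fD; have := fD h h hP hP; rewrite FinRing.zmodMgE -[h + h]mulr2n h2.
  have P1 := group1 P; have := fD 1%g 1%g P1 P1; rewrite mulg1 FinRing.zmod1gE => e e'.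
  by rewrite mulr2n -e'; apply: (@addrI _ (f 0)); rewrite addr0; apply: esym e.
case: cardP => cardP.
  have [f [fD f0]] := cyclic_hom cP cardP isT.
  (* For P of order 2 the values are doubled, so that [h] has level 2 here too. *)
  exists P, (fun a => (2 * f (a *+ m)%R)%N); split=> // [a b|].
    rewrite mulrnDl -FinRing.zmodMgE fD //.
    by move: (f _) (f _) => [[|[|]] //= ?] [[|[|]] //= ?].
  rewrite hm; have := f0 h hP; rewrite FinRing.zmod1gE (negPf nh).
  by move: (f h) => [[|[|]] //= ?].
have [f [fD f0]] := cyclic_hom cP cardP isT.
exists P, (fun a => f (a *+ m)%R : nat); split=> // [a b|].
  by rewrite mulrnDl -FinRing.zmodMgE fD.
rewrite hm; have := f0 h hP; rewrite FinRing.zmod1gE (negPf nh).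
have := fh0 _ f fD; move: (f h) => x e.
by case: x e => [[|[|[|[|]]]] //= ?] /(congr1 val).
Qed.

Section Extension.

Variables (A : finZmodType) (h : A) (lev : A -> nat) (P : {group A}).
Hypotheses (sylP : (2.-Sylow([set: A]) P)%g) (hP : h \in P).
Hypotheses (levD : forall a b, lev (a + b) = ((lev a + lev b) %% 4)%N)
  (lev_h : lev h = 2%N).
Hypothesis Fp_ok : forall p, prime p -> odd p -> (p %| #|A|)%N ->
  [/\ (5 <= p)%N, (p %% 4 = 1)%N & exists m, selector 0 [set: 'F_p] m].

(** By Cauchy, A / K has a subgroup of prime order q, and L is its preimage. As K contains the Sylow
    2-subgroup, q is odd and the rules on the field of order q apply. *)
Lemma selector_extend (K : {group A}) : P \subset K -> K \proper [set: A] ->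
  (exists m, selector h K m) ->
  exists L : {group A}, K \proper L /\ exists m, selector h L m.
Proof.
move=> PK pK [mK sK]; have KT := subsetT K.
have nKT := normal_norm (zmod_sub_normal KT).
have cardQ := card_quotient nKT.
have Q1 : (1 < #|[set: A] / K|%g)%N by rewrite cardQ indexg_gt1 (proper_subn pK).
set q := pdiv #|[set: A] / K|%g; have pq : prime q by apply: pdiv_prime.
have [y yQ oy] := Cauchy pq (pdiv_dvd _).
pose L := (coset K @*^-1 <[y]>)%G.
have KL : K \subset L by apply: sub_cosetpre.
have LK : (L / K)%g = <[y]>%g by rewrite /= cosetpreK.
have cardL : #|L / K|%g = q by rewrite LK -orderE oy.
have qd : (q %| #|[set: A] : K|%g)%N by rewrite -cardQ pdiv_dvd.
have qA : (q %| #|A|)%N by rewrite (dvdn_trans qd) // -cardsT dvdn_indexg.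
have oq : odd q.
  case: (even_prime pq) => // q2; case/and3P: sylP => _ _.
  rewrite p'natE // -(Lagrange_index KT PK) => /negP[].
  by rewrite dvdn_mulr // -q2.
have [q5 q4 [m0 sm0]] := Fp_ok pq oq qA.
have [phi [phiD phi0]] := index_prime_hom KL pq cardL.
have [PP [QQ [PQ [[P1 Q1' PQ1] [P2 PQ0 QQ0 Q2]]]]] := edge_rules_exist pq q4.
have hL : h \in L by rewrite (subsetP KL) // (subsetP PK).
have phi_h : phi h = 0 by apply/eqP; rewrite phi0 // (subsetP PK).
have EK : [set x in L | phi x == 0] = K.
  apply/setP => x; rewrite inE; apply/andP/idP => [[xL]|xK]; first by rewrite phi0.
  by have xL := subsetP KL x xK; rewrite phi0.
exists L; split.
  rewrite properE KL /=; apply/negP => LsubK.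
  have : (1 < #|L / K|%g)%N by rewrite cardL prime_gt1.
  by rewrite quotientS1 // cards1.
rewrite -EK in sK.
exists (step_rule lev phi m0 PP QQ PQ mK).
by apply: step_selector.
Qed.

Lemma selector_total : (exists m, selector h P m) -> exists m, selector h [set: A] m.
Proof.
move=> sP; suff gen n : forall K : {group A}, (#|A| - #|K| <= n)%N -> P \subset K ->
    (exists m, selector h K m) -> exists m, selector h [set: A] m.
  exact: gen (leqnn _) (subxx P) sP.
elim: n => [|n IH] K leK PK sK; have [pK|] := boolP (K \proper [set: A]).
- by have := proper_card pK; rewrite cardsT; move: leK; rewrite leqn0 subn_eq0 leqNgt => /negP.
- by rewrite properT negbK => /eqP <-.
- have [L [KL sL]] := selector_extend PK pK sK; apply: IH sL.
    by have := proper_card KL; lia.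
  exact: subset_trans PK (proper_sub KL).
- by rewrite properT negbK => /eqP <-.
Qed.

End Extension.

Lemma system_sufficient (A : finZmodType) : cyclic_Sylow2 A ->
  #|A| = 0 %[mod 2] -> #|A| <> 0 %[mod 3] -> #|A| <> 0 %[mod 8] ->
  (forall p : nat, prime p -> odd p -> (p %| #|A|)%N -> has_S_cyclic_SQS (2 * p)%N) ->
  has_reversible_SQS A.
Proof.
rewrite !mod0n => cyc /eqP d2 /eqP d3 /eqP d8 hp.
have [h [nh t2]] := torsion2_ex cyc d2.
have [P [lev [sylP hP ndP levD lev_h]]] := Sylow2_level cyc nh t2 d2 d8.
have Fp_ok p : prime p -> odd p -> (p %| #|A|)%N ->
    [/\ (5 <= p)%N, (p %% 4 = 1)%N & exists m, selector 0 [set: 'F_p] m].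
  move=> pp op pA; have [m sm] := Fp_selector pp op (hp p pp op pA).
  have p5 : (5 <= p)%N.
    rewrite leqNgt; apply/negP => p4; move: pp op pA p4; clear -d3.
    by case: p => [|[|[|[|[|]]]]] // _ _ d; case/negP: d3.
  by split=> //; [apply: selector_mod4 sm|exists m].
have sP : exists m, selector h P m.
  (* The chain starts for free: P contains no nondegenerate triple. *)
  by exists (fun _ _ => true); split=> // a b aP bP n; case/negP: (ndP a b aP bP).
have [m sm] := selector_total sylP hP levD lev_h Fp_ok sP.
exact: system_of_selector t2 nh (torsion3_free_card d3) sm.
Qed.

(* The equivalence of the four statements *)
Local Close Scope ring_scope.

Theorem theorem7p1 (v : nat) (hv : (8 <= v)%N) :
  [<-> (forall A : finZmodType,
          #|A| = v -> cyclic_Sylow2 A -> has_reversible_SQS A);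
       (exists A : finZmodType,
          [/\ #|A| = v, cyclic_Sylow2 A & has_reversible_SQS A]);
       has_S_cyclic_SQS v;
       [/\ v = 0 %[mod 2], v <> 0 %[mod 3], v <> 0 %[mod 8]
         & forall p : nat, prime p -> odd p -> (p %| v)%N ->
             has_S_cyclic_SQS (2 * p)%N]].
Proof.
have v1 : (1 < v)%N by apply: leq_trans hv.
have cardZ : #|'Z_v| = v by rewrite -cardsT Zp_set_card.
have iv_i : [/\ v = 0 %[mod 2], v <> 0 %[mod 3], v <> 0 %[mod 8]
      & forall p : nat, prime p -> odd p -> (p %| v)%N -> has_S_cyclic_SQS (2 * p)%N] ->
    forall A : finZmodType, #|A| = v -> cyclic_Sylow2 A -> has_reversible_SQS A.
  move=> [d2 d3 d8 hp] A cA cyc.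
  by apply: system_sufficient => //; rewrite cA.
have i_iii : (forall A : finZmodType, #|A| = v -> cyclic_Sylow2 A -> has_reversible_SQS A) ->
    has_S_cyclic_SQS v.
  by move=> all; apply: all cardZ (@Zp_cyclic_Sylow2 v).
have ii_iv : (exists A : finZmodType,
      [/\ #|A| = v, cyclic_Sylow2 A & has_reversible_SQS A]) ->
    [/\ v = 0 %[mod 2], v <> 0 %[mod 3], v <> 0 %[mod 8]
      & forall p : nat, prime p -> odd p -> (p %| v)%N -> has_S_cyclic_SQS (2 * p)%N].
  by move=> [A [cA cyc hA]]; rewrite -cA; apply: system_necessary; rewrite ?cA.
have iii_ii : has_S_cyclic_SQS v -> exists A : finZmodType,
    [/\ #|A| = v, cyclic_Sylow2 A & has_reversible_SQS A].
  by move=> hv'; exists 'Z_v; split=> //; apply: Zp_cyclic_Sylow2.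
(* The implications required here are composed from the cycle (iv), (i), (iii), (ii), (iv). *)
tfae.
- by move=> /i_iii/iii_ii.
- by move=> /ii_iv/iv_i/i_iii.
- by move=> /iii_ii/ii_iv.
- exact: iv_i.
Qed.
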